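(* Let $(\mathcal{C},\mathcal{D})$ be a $C^*$-inclusion with $\mathcal{D}$ abelian. Then the following are equivalent: (i) $(\mathcal{C},\mathcal{D})$ has the unique pseudo-expectation property. (ii) For all $x \in \mathcal{C}_{sa}$, $$\sup\nolimits_{I(\mathcal{D})}\{d \in \mathcal{D}_{sa} : d \leq x\} = \inf\nolimits_{I(\mathcal{D})}\{d \in \mathcal{D}_{sa} : d \geq x\}.$$
   Context: All $C^*$-algebras are unital. A $C^*$-inclusion $(\mathcal{C},\mathcal{D})$ is a pair of unital $C^*$-algebras with $\mathcal{D} \subseteq \mathcal{C}$ and having the same unit. ''ucp'' means unital completely positive. A $C^*$-algebra is injective if it is an injective object in the category of operator systems and ucp maps. $I(\mathcal{D})$ denotes a fixed injective envelope of $\mathcal{D}$: an injective unital $C^*$-algebra containing $\mathcal{D}$ as a unital $C^*$-subalgebra, such that for every injective operator system $\mathcal{S}$ and unital complete isometry $\tau:\mathcal{D}\to\mathcal{S}$ there is a unital complete isometry $\tau_1:I(\mathcal{D})\to\mathcal{S}$ with $\tau_1|_{\mathcal{D}}=\tau$. A pseudo-expectation for $(\mathcal{C},\mathcal{D})$ is a ucp map $\Phi:\mathcal{C}\to I(\mathcal{D})$ with $\Phi|_{\mathcal{D}}=\operatorname{id}$; the inclusion has the unique pseudo-expectation property if exactly one pseudo-expectation exists. The subscript $sa$ denotes self-adjoint elements. When $\mathcal{D}$ is abelian, $I(\mathcal{D})$ is abelian and order complete, i.e. every nonempty subset of $I(\mathcal{D})_{sa}$ with an upper (lower) bound has a supremum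 (infimum) in $I(\mathcal{D})_{sa}$; $\sup_{I(\mathcal{D})}$ and $\inf_{I(\mathcal{D})}$ denote these. The inequalities $d\le x$, $d\ge x$ are in $\mathcal{C}_{sa}$. *)

(* Defs.v *)
From HB Require Import structures.
From mathcomp Require Import all_boot all_order all_algebra.
From mathcomp Require Import complex.
From mathcomp Require Import all_classical all_reals.

Set Implicit Arguments.
Unset Strict Implicit.
Unset Printing Implicit Defensive.

Import Order.TTheory GRing.Theory Num.Theory.

Local Open Scope classical_set_scope.
Local Open Scope ring_scope.

(** Unital C*-algebras.  As the carrier is an [algType], [1 != 0] holds.  The
    norm is a field of the mixin because the library has no join of [algType]
    and [normedModType]. *)
HB.mixin Record isCStar (R : realType) A & GRing.Algebra R[i] A := {
  star : A -> A ;
  cnorm : A -> R ;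
  starK : involutive star ;
  starD : forall x y : A, star (x + y) = star x + star y ;
  starZ : forall (a : R[i]) (x : A), star (a *: x) = conjc a *: star x ;
  starM : forall x y : A, star (x * y) = star y * star x ;
  cnorm_eq0 : forall x : A, cnorm x = 0 -> x = 0 ;
  cnormD : forall x y : A, cnorm (x + y) <= cnorm x + cnorm y ;
  cnormZ : forall (a : R[i]) (x : A),
    cnorm (a *: x) = ComplexField.Normc.normc a * cnorm x ;
  cnormM : forall x y : A, cnorm (x * y) <= cnorm x * cnorm y ;
  cnorm_star : forall x : A, cnorm (star x * x) = cnorm x ^+ 2 ;
  cnorm_complete : forall u : nat -> A,
    (forall e : R, 0 < e -> exists N : nat, forall m n : nat,
       (N <= m)%N -> (N <= n)%N -> cnorm (u m - u n) < e) ->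
    exists l : A, forall e : R, 0 < e -> exists N : nat, forall n : nat,
      (N <= n)%N -> cnorm (u n - l) < e
}.

#[short(type="cstarAlgType")]
HB.structure Definition CStar (R : realType) :=
  {A of GRing.Algebra R[i] A & isCStar R A}.

Section CStarOrder.
Context {R : realType} {A : cstarAlgType R}.

Definition selfadj (x : A) : Prop := star x = x.

Definition starmx m n (X : 'M[A]_(m, n)) : 'M[A]_(n, m) := (map_mx star X)^T.

(** Positivity in the C*-algebra ['M[A]_n]. The order of a C*-algebra is
    defined by its elements of the form [y^* y]. *)
Definition posmx n (X : 'M[A]_n) : Prop :=
  exists Y : 'M[A]_n, X = starmx Y *m Y.

Definition cstar_pos (x : A) : Prop := exists y : A, x = star y * y.

Definition cstar_le (x y : A) : Prop := cstar_pos (y - x).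

Definition is_sup_sa (S : set A) (s : A) : Prop :=
  [/\ selfadj s,
      forall d, S d -> cstar_le d s &
      forall u, selfadj u -> (forall d, S d -> cstar_le d u) -> cstar_le s u].

Definition is_inf_sa (S : set A) (s : A) : Prop :=
  [/\ selfadj s,
      forall d, S d -> cstar_le s d &
      forall u, selfadj u -> (forall d, S d -> cstar_le u d) -> cstar_le u s].

(** The norm of a column [v] in the Hilbert A-module A^n, that is
    |sum_i v_i^* v_i|^(1/2). *)
Definition colnorm n (v : 'cV[A]_n) : R :=
  Num.sqrt (cnorm ((starmx v *m v) ord0 ord0)).

(** The C*-norm of ['M[A]_n]: the operator norm of [X] acting on A^n. *)
Definition cstar_mxnorm n (X : 'M[A]_n) : R :=
  sup [set colnorm (X *m v) | v in [set v : 'cV[A]_n | colnorm v <= 1]].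

End CStarOrder.

Section OperatorSystems.
Context {R : realType}.

(** An operator system is a unital self-adjoint linear subspace of a unital
    C*-algebra; it inherits matrix order and matrix norms from the latter.
    Maps between operator systems are represented by functions between the
    ambient algebras, of which only the values on the domain matter. *)
Definition operator_system (A : cstarAlgType R) (S : set A) : Prop :=
  [/\ S 1,
      forall (a : R[i]) x y, S x -> S y -> S (a *: x + y) &
      forall x, S x -> S (star x)].

Section Maps.
Context {A B : cstarAlgType R}.
Implicit Types (S : set A) (T : set B) (phi : A -> B).

Definition unital_linear_on S T phi : Prop :=
  [/\ forall x, S x -> T (phi x),
      forall (a : R[i]) x y, S x -> S y ->
        phi (a *: x + y) = a *: phi x + phi y &
      phi 1 = 1].

Definition ucp S T phi : Prop :=
  unital_linear_on S T phi /\
  forall n (X : 'M[A]_n), (forall i j, S (X i j)) ->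
    posmx X -> posmx (map_mx phi X).

Definition unital_complete_isometry S T phi : Prop :=
  unital_linear_on S T phi /\
  forall n (X : 'M[A]_n), (forall i j, S (X i j)) ->
    cstar_mxnorm (map_mx phi X) = cstar_mxnorm X.

(** The domain identified with a unital C*-subalgebra of the codomain. *)
Definition cstar_embedding (j : {lrmorphism A -> B}) : Prop :=
  (forall x, j (star x) = star (j x)) /\ (forall x, cnorm (j x) = cnorm x).

End Maps.

Definition injective_operator_system (A : cstarAlgType R) (T : set A) :
    Prop :=
  operator_system T /\
  forall (B : cstarAlgType R) (E F : set B),
    operator_system E -> operator_system F -> E `<=` F ->
  forall phi : B -> A, ucp E T phi ->
  exists psi : B -> A, ucp F T psi /\ (forall x, E x -> psi x = phi x).

Definition injective_envelope (D I : cstarAlgType R)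
    (j : {lrmorphism D -> I}) : Prop :=
  [/\ cstar_embedding j,
      injective_operator_system [set: I] &
      forall (B : cstarAlgType R) (S : set B),
        injective_operator_system S ->
      forall tau : D -> B, unital_complete_isometry setT S tau ->
      exists tau1 : I -> B,
        unital_complete_isometry setT S tau1 /\
        (forall d, tau1 (j d) = tau d)].

Section PseudoExpectation.
Context {C D I : cstarAlgType R}.
Variables (jC : {lrmorphism D -> C}) (jI : {lrmorphism D -> I}).

Definition pseudo_expectation (Phi : C -> I) : Prop :=
  ucp setT setT Phi /\ forall d, Phi (jC d) = jI d.

Definition unique_pseudo_expectation : Prop :=
  exists! Phi : C -> I, pseudo_expectation Phi.

Definition minorants (x : C) : set I :=
  [set jI d | d in [set d | selfadj d /\ cstar_le (jC d) x]].

Definition majorants (x : C) : set I :=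
  [set jI d | d in [set d | selfadj d /\ cstar_le x (jC d)]].

End PseudoExpectation.

End OperatorSystems.

(* Main.v *)
Require Import Defs.
From HB Require Import structures.
From mathcomp Require Import all_boot all_order all_algebra.
From mathcomp Require Import complex.
From mathcomp Require Import all_classical all_reals.
From mathcomp Require Import ring lra.

Set Implicit Arguments.
Unset Strict Implicit.
Unset Printing Implicit Defensive.

Import Order.TTheory GRing.Theory Num.Theory.

Local Open Scope classical_set_scope.
Local Open Scope ring_scope.

Local Notation Re := complex.Re.
Local Notation Im := complex.Im.

(** If [Phi] is a pseudo-expectation and [x] is self-adjoint, then positivity
    gives [jI d <= Phi x <= jI d'] whenever [jC d <= x <= jC d'].  So when the
    supremum [s] of the minorants is also the infimum of the majorants,
    [s <= Phi x <= s], which determines [Phi x]; existence holds because [I] is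
    injective and [jI \o jC^-1] is ucp on the range of [jC].

    Conversely, for each self-adjoint [x] there is a pseudo-expectation whose
    value at [x] is the supremum of the minorants
    ([pseudo_expectation_sup]) and another whose value there is the infimum of
    the majorants ([pseudo_expectation_inf]); if there is only one
    pseudo-expectation the two bounds agree.

    The commutativity of [D] enters as follows.  Characters separate the points
    of [D], so evaluation embeds [D] completely isometrically in the algebra of
    bounded functions on its characters ([gelfand]), and this algebra is
    injective ([linf_injective]).  By the property of the envelope, [I] embeds
    completely isometrically in it too, by a map [tau], and since [I] is
    injective there is a ucp map [rho] back with [rho \o tau] the identity
    ([injective_retract]).  Thus a map into [I] can be built one character [p]
    at a time: the state [d |-> tau (jI d) p] of [D] extends to a state of [C]
    whose value at [x] is the supremum of the values at the minorants of [x]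
    ([state_extension]), these states are the coordinates of a ucp map of [C]
    into the bounded functions ([state_map_ucp]), and [rho] maps it to [I].

    The theory of positive elements below rests on a single construction, the
    square root of [1 - T] for [|T| <= 1] ([sqrt_one_sub]), in place of
    spectra.  An element is called positive ([psd]) when it is self-adjoint and
    [|c - a| <= c] for some [c >= 0]; by the theorem of Kelley and Vaught
    ([psd_starM]) these are the elements [y^* y].  Everything is then applied
    to the C*-algebra of matrices over [A] ([cmatrix]), where it shows that
    injective star homomorphisms and unital complete isometries both preserve
    and reflect the positivity of matrices. *)

(** * Real scalars, the norm and self-adjoint elements *)

Local Notation "r *r x" := ((r%:C)%C *: x) (at level 40, left associativity).

Section RealScalars.
Context {R : realType} {V : lmodType R[i]}.
Implicit Types (r s : R) (x y : V).

Lemma rscaleA r s x : r *r (s *r x) = (r * s) *r x.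
Proof. by rewrite scalerA rmorphM. Qed.

Lemma rscaleDl r s x : (r + s) *r x = r *r x + s *r x.
Proof. by rewrite rmorphD scalerDl. Qed.

Lemma rscaleBl r s x : (r - s) *r x = r *r x - s *r x.
Proof. by rewrite rmorphB scalerBl. Qed.

Lemma rscaleNl r x : (- r) *r x = - (r *r x).
Proof. by rewrite rmorphN scaleNr. Qed.

Lemma rscale1 x : 1 *r x = x.
Proof. by rewrite rmorph1 scale1r. Qed.

Lemma rscale0 x : 0 *r x = 0.
Proof. by rewrite rmorph0 scale0r. Qed.

Lemma rscale2 x : 2 *r x = x + x.
Proof. by rewrite -{1}[2]/(1 + 1) rscaleDl rscale1. Qed.

Lemma rscaleK r x : r != 0 -> r *r (r^-1 *r x) = x.
Proof. by move=> r0; rewrite rscaleA divff // rscale1. Qed.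

Lemma rscaleVK r x : r != 0 -> r^-1 *r (r *r x) = x.
Proof. by move=> r0; rewrite rscaleA mulVf // rscale1. Qed.

End RealScalars.

Section Norm.
Context {R : realType} {A : cstarAlgType R}.
Implicit Types (r s : R) (x y a b : A).

Lemma star0 : star (0 : A) = 0.
Proof. by apply: (addrI (star 0)); rewrite -starD !addr0. Qed.

Lemma starN x : star (- x) = - star x.
Proof. by apply: (addrI (star x)); rewrite -starD !subrr star0. Qed.

Lemma starB x y : star (x - y) = star x - star y.
Proof. by rewrite starD starN. Qed.

Lemma starR r x : star (r *r x) = r *r star x.
Proof. by rewrite starZ /= oppr0. Qed.

Lemma star1 : star (1 : A) = 1.
Proof.
have := starM (star 1) (1 : A).
by rewrite starK mulr1 starK.
Qed.

Lemma star_sum (I : Type) (s : seq I) (P : pred I) (F : I -> A) :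
  star (\sum_(i <- s | P i) F i) = \sum_(i <- s | P i) star (F i).
Proof. exact: (big_morph star starD star0). Qed.

Lemma cnormR r x : cnorm (r *r x) = `|r| * cnorm x.
Proof. by rewrite cnormZ /= expr0n /= addr0 sqrtr_sqr. Qed.

Lemma cnorm0 : cnorm (0 : A) = 0.
Proof. by rewrite -(rscale0 (0 : A)) cnormR normr0 mul0r. Qed.

Lemma cnormN x : cnorm (- x) = cnorm x.
Proof. by rewrite -[x in - x]rscale1 -rscaleNl cnormR normrN normr1 mul1r. Qed.

Lemma cnorm_ge0 x : 0 <= cnorm x.
Proof. by have := cnormD x (- x); rewrite subrr cnorm0 cnormN; lra. Qed.

Lemma cnormB x y : cnorm (x - y) <= cnorm x + cnorm y.
Proof. by rewrite -(cnormN y) cnormD. Qed.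

Lemma cnorm_distC x y : cnorm (x - y) = cnorm (y - x).
Proof. by rewrite -opprB cnormN. Qed.

Lemma cnorm_starE x : cnorm (star x) = cnorm x.
Proof.
suff le y : cnorm y <= cnorm (star y).
  by apply/eqP; rewrite eq_le le andbT; have := le (star x); rewrite starK.
have := cnormM (star y) y; rewrite cnorm_star expr2.
have [y0|y0] := eqVneq (cnorm y) 0; first by rewrite y0 cnorm_ge0.
by rewrite ler_pM2r // lt_def y0 cnorm_ge0.
Qed.

Lemma cnorm1 : cnorm (1 : A) = 1.
Proof.
have := cnorm_star (1 : A); rewrite star1 mulr1 expr2 => /eqP.
rewrite -subr_eq0 -{1}[cnorm 1]mulr1 -mulrBr mulf_eq0 => /orP[/eqP/cnorm_eq0/eqP|].
  by rewrite oner_eq0.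
by rewrite subr_eq0 => /eqP.
Qed.

Lemma cnorm_scalar r : cnorm (r *r (1 : A)) = `|r|.
Proof. by rewrite cnormR cnorm1 mulr1. Qed.

Lemma cnorm_sqr x : selfadj x -> cnorm (x * x) = cnorm x ^+ 2.
Proof. by rewrite -{2}/(selfadj x) => sx; rewrite -{1}sx cnorm_star. Qed.

(** The form in which limits enter: an estimate by an arbitrarily small
    multiple of a constant forces equality. *)
Lemma cnorm_small x (K : R) : (forall e, 0 < e -> cnorm x <= K * e) -> x = 0.
Proof.
move=> h; apply: cnorm_eq0; apply/eqP; rewrite eq_le cnorm_ge0 andbT.
rewrite leNgt; apply/negP => x0.
have K1 : 0 < `|K| + 1 by have := normr_ge0 K; lra.
have := h (cnorm x / (2 * (`|K| + 1))); rewrite divr_gt0 ?mulr_gt0 // => /(_ isT).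
apply/negP; rewrite -ltNge mulrA ltr_pdivrMr ?mulr_gt0 //.
by have := ler_norm K; nra.
Qed.

Lemma selfadj0 : selfadj (0 : A). Proof. exact: star0. Qed.
Lemma selfadj1 : selfadj (1 : A). Proof. exact: star1. Qed.
Lemma selfadjN x : selfadj x -> selfadj (- x).
Proof. by rewrite /selfadj starN => ->. Qed.
Lemma selfadjD x y : selfadj x -> selfadj y -> selfadj (x + y).
Proof. by rewrite /selfadj starD => -> ->. Qed.
Lemma selfadjB x y : selfadj x -> selfadj y -> selfadj (x - y).
Proof. by rewrite /selfadj starB => -> ->. Qed.
Lemma selfadjR r x : selfadj x -> selfadj (r *r x).
Proof. by rewrite /selfadj starR => ->. Qed.
Lemma selfadj_scalar r : selfadj (r *r (1 : A)).
Proof. exact/selfadjR/selfadj1. Qed.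
Lemma selfadjM x y : selfadj x -> selfadj y -> x * y = y * x -> selfadj (x * y).
Proof. by rewrite /selfadj starM => -> ->. Qed.
Lemma selfadj_sqr x : selfadj x -> selfadj (x * x).
Proof. by move=> sx; apply: selfadjM. Qed.
Lemma selfadj_starM x : selfadj (star x * x).
Proof. by rewrite /selfadj starM starK. Qed.

(** The scalar [0 -i* 2^-1] is [1 / 2i]. *)
Definition rpart x : A := 2^-1 *r (x + star x).
Definition ipart x : A := (0 -i* 2^-1)%C *: (x - star x).

Lemma half_split x : x = 2^-1 *r x + 2^-1 *r x.
Proof. by rewrite -rscaleDl -[LHS]rscale1; congr (_%:C%C *: _); field. Qed.

Lemma selfadj_rpart x : selfadj (rpart x).
Proof. by rewrite /rpart; apply: selfadjR; rewrite /selfadj starD starK addrC. Qed.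

Lemma selfadj_ipart x : selfadj (ipart x).
Proof.
rewrite /selfadj /ipart starZ starB starK -[star x - x]opprB scalerN -scaleNr.
by congr (_ *: _); apply/eqP; rewrite eq_complex /= oppr0 opprK !eqxx.
Qed.

Lemma imulK x : 'i%C *: ((0 -i* 2^-1)%C *: x) = 2^-1 *r x.
Proof.
rewrite scalerA; congr (_ *: _); apply/eqP.
by rewrite eq_complex /= !mul0r mulr0 mul1r !sub0r opprK addr0 !eqxx.
Qed.

Lemma ri_partE x : x = rpart x + 'i%C *: ipart x.
Proof.
by rewrite /ipart imulK -scalerDr addrACA subrr addr0 scalerDr -half_split.
Qed.

Lemma star_i x : star ('i%C *: x) = - ('i%C *: star x).
Proof.
rewrite starZ -scaleNr; congr (_ *: _).
by apply/eqP; rewrite eq_complex /= oppr0 !eqxx.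
Qed.

Lemma i_sqr x : 'i%C *: ('i%C *: x) = - x.
Proof. by rewrite scalerA -expr2 sqr_i scaleN1r. Qed.

Lemma cnorm_i x : cnorm ('i%C *: x) = cnorm x.
Proof. by rewrite cnormZ /= expr0n expr1n /= add0r sqrtr1 mul1r. Qed.

Lemma rpart_sa x : selfadj x -> rpart x = x.
Proof. by rewrite /selfadj /rpart => ->; rewrite scalerDr -half_split. Qed.

Lemma ipart_sa x : selfadj x -> ipart x = 0.
Proof. by rewrite /selfadj /ipart => ->; rewrite subrr scaler0. Qed.

Lemma cnorm_rpart x : cnorm (rpart x) <= cnorm x.
Proof.
rewrite /rpart cnormR ger0_norm ?invr_ge0 ?ler0n //.
by have := cnormD x (star x); rewrite cnorm_starE; lra.
Qed.

Lemma cnorm_ipart x : cnorm (ipart x) <= cnorm x.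
Proof.
rewrite -cnorm_i /ipart imulK cnormR ger0_norm ?invr_ge0 ?ler0n //.
by have := cnormB x (star x); rewrite cnorm_starE; lra.
Qed.

Lemma starM_ri a b : selfadj a -> selfadj b ->
  star (a + 'i%C *: b) * (a + 'i%C *: b) =
    a * a + b * b + 'i%C *: (a * b - b * a).
Proof.
move=> sa sb; rewrite starD star_i sa sb mulrDl !mulrDr mulNr.
rewrite -!scalerAl -!scalerAr mulNr -scalerAl scalerN i_sqr opprK scalerBr.
by rewrite [- _ + b * b]addrC addrACA.
Qed.

Lemma Mstar_ri a b : selfadj a -> selfadj b ->
  (a + 'i%C *: b) * star (a + 'i%C *: b) =
    a * a + b * b - 'i%C *: (a * b - b * a).
Proof.
move=> sa sb; rewrite starD star_i sa sb mulrDl !mulrDr !mulrN.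
rewrite -!scalerAl -!scalerAr i_sqr opprK scalerBr opprB.
by rewrite ['i%C *: _ + b * b]addrC addrACA [- _ + _]addrC.
Qed.

Lemma rpart_ri a b : selfadj a -> selfadj b -> rpart (a + 'i%C *: b) = a.
Proof.
move=> sa sb; rewrite /rpart starD star_i sa sb addrACA subrr addr0 scalerDr.
by rewrite -half_split.
Qed.

Lemma ipart_ri a b : selfadj a -> selfadj b -> ipart (a + 'i%C *: b) = b.
Proof.
move=> sa sb; set x := a + _.
have : 'i%C *: ipart x = 'i%C *: b.
  by apply: (addrI a); rewrite -[X in X + _](rpart_ri sa sb) -ri_partE.
by move/(congr1 (fun y => - ('i%C *: y))); rewrite !i_sqr !opprK.
Qed.

(** [|a + ib|^2 = |c|] and an element dominates its real part. *)
Lemma cnorm_sqD a b (c : R) : selfadj a -> selfadj b -> a * b = b * a ->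
  a * a + b * b = c *r 1 -> cnorm a ^+ 2 <= `|c|.
Proof.
move=> sa sb ab h.
have /= := cnorm_star (a + 'i%C *: b).
rewrite starM_ri // ab subrr scaler0 addr0 h cnorm_scalar => ->.
rewrite ler_pXn2r ?nnegrE ?cnorm_ge0 //.
by rewrite -{1}(rpart_ri sa sb) cnorm_rpart.
Qed.

End Norm.

(** * Square roots by iteration *)

Lemma nondecreasing_bounded_cauchy (R : realType) (u : nat -> R) (M : R) :
  (forall k, u k <= u k.+1) -> (forall k, u k <= M) ->
  forall e, 0 < e -> exists N, forall n, (N <= n)%N -> u n - u N < e.
Proof.
move=> u_nd u_M e e0.
have sup_u : has_sup (range u).
  by split; [exists (u 0), 0 | exists M => _ [k _ <-]].
have [_ [N _ <-] hN] := sup_adherent e0 sup_u.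
exists N => n Nn; have : u n <= sup (range u).
  by apply: ub_le_sup; [case: sup_u | exists n].
by lra.
Qed.

Section SquareRoot.
Context {R : realType} {A : cstarAlgType R}.
Implicit Types (r s : R) (T a b : A).

Definition sqrt_iter T k : A := iter k (fun Z => 2^-1 *r (T + Z * Z)) 0.

(** The scalar case [T = 1], which dominates all the others. *)
Definition sqrt_bound k : R := iter k (fun z => (1 + z ^+ 2) / 2) 0.

Lemma sqrt_bound_ge0 k : 0 <= sqrt_bound k.
Proof. by case: k => //= k; rewrite divr_ge0 ?addr_ge0 ?sqr_ge0. Qed.

Lemma sqrt_bound_le1 k : sqrt_bound k <= 1.
Proof. by elim: k => //= k IH; have := sqrt_bound_ge0 k; nra. Qed.

Lemma sqrt_bound_nd k : sqrt_bound k <= sqrt_bound k.+1.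
Proof. by have := sqr_ge0 (sqrt_bound k - 1); rewrite /=; nra. Qed.

Lemma half_ge0 : 0 <= 2^-1 :> R. Proof. by rewrite invr_ge0. Qed.

Lemma cnorm_sqrt_iter T k : cnorm T <= 1 -> cnorm (sqrt_iter T k) <= sqrt_bound k.
Proof.
move=> T1; elim: k => [|k IH] /=; first by rewrite cnorm0.
rewrite cnormR ger0_norm ?half_ge0 //.
have := cnormD T (sqrt_iter T k * sqrt_iter T k).
have := cnormM (sqrt_iter T k) (sqrt_iter T k).
by have := cnorm_ge0 (sqrt_iter T k); nra.
Qed.

Lemma sqrt_iter_step T k : cnorm T <= 1 ->
  cnorm (sqrt_iter T k.+1 - sqrt_iter T k) <= sqrt_bound k.+1 - sqrt_bound k.
Proof.
move=> T1; elim: k => [|k IH].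
  rewrite /= expr0n /= mul0r !subr0 !addr0 cnormR ger0_norm ?half_ge0 //; lra.
have nk1 := cnorm_sqrt_iter k.+1 T1; have nk := cnorm_sqrt_iter k T1.
set z := sqrt_iter T k.+1 in IH nk1 *; set y := sqrt_iter T k in IH nk.
have -> : sqrt_iter T k.+2 - z = 2^-1 *r (z * (z - y) + (z - y) * y).
  rewrite {2}/z /= -/y -/z -scalerBr opprD addrACA subrr add0r.
  by rewrite mulrBr mulrBl addrA addrNK.
have -> : sqrt_bound k.+2 - sqrt_bound k.+1 =
    2^-1 * ((sqrt_bound k.+1 + sqrt_bound k) * (sqrt_bound k.+1 - sqrt_bound k)).
  by rewrite /=; field.
rewrite cnormR ger0_norm ?half_ge0 // ler_pM2l ?invr_gt0 //.
apply: le_trans (cnormD _ _) _.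
apply: le_trans (lerD (cnormM _ _) (cnormM _ _)) _.
rewrite [cnorm (z - y) * _]mulrC -mulrDl.
by apply: ler_pM => //; rewrite ?addr_ge0 ?cnorm_ge0 // lerD.
Qed.

Lemma sqrt_iter_cauchy T m n : cnorm T <= 1 -> (n <= m)%N ->
  cnorm (sqrt_iter T m - sqrt_iter T n) <= sqrt_bound m - sqrt_bound n.
Proof.
move=> T1 /subnK <-; elim: (m - n)%N => [|k IH]; first by rewrite !subrr cnorm0.
rewrite addSn -(subrKA (sqrt_iter T (k + n))).
apply: le_trans (cnormD _ _) _.
by have := sqrt_iter_step (k + n) T1; lra.
Qed.

Lemma sqrt_iter_limit T : cnorm T <= 1 -> exists S : A, forall e : R, 0 < e ->
  exists k, cnorm (sqrt_iter T k - S) < e /\ cnorm (sqrt_iter T k.+1 - S) < e.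
Proof.
move=> T1.
have cau e : 0 < e -> exists N, forall m n, (N <= m)%N -> (N <= n)%N ->
    cnorm (sqrt_iter T m - sqrt_iter T n) < e.
  move=> e0; have e2 : 0 < e / 2 by lra.
  have [N hN] := nondecreasing_bounded_cauchy sqrt_bound_nd sqrt_bound_le1 e2.
  exists N => m n Nm Nn; rewrite -(subrKA (sqrt_iter T N)).
  apply: le_lt_trans (cnormD _ _) _; rewrite [X in _ + X]cnorm_distC.
  have := hN _ Nm; have := hN _ Nn.
  by have := sqrt_iter_cauchy T1 Nm; have := sqrt_iter_cauchy T1 Nn; lra.
have [S hS] := cnorm_complete (sqrt_iter T) cau; exists S => e e0.
by have [N hN] := hS e e0; exists N; split; apply: hN.
Qed.

(** [S = lim Z_k], where [Z_0 = 0] and [Z_{k+1} = (T + Z_k^2) / 2], solves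
    [S = (T + S^2) / 2], that is [(1 - S)^2 = 1 - T].  The iteration converges
    because it is dominated by the bounded monotone one for [T = 1]. *)
Lemma sqrt_one_sub T : selfadj T -> cnorm T <= 1 -> exists w : A,
  [/\ selfadj w, w * w = 1 - T, cnorm (1 - w) <= 1 &
      forall b, b * T = T * b -> b * w = w * b].
Proof.
move=> sT T1; have [S hS] := sqrt_iter_limit T1.
have Z1 k : cnorm (sqrt_iter T k) <= 1.
  exact: le_trans (cnorm_sqrt_iter k T1) (sqrt_bound_le1 k).
have S1 : cnorm S <= 1.
  rewrite leNgt; apply/negP; rewrite -subr_gt0 => /hS [k [hk _]].
  have := cnormB (sqrt_iter T k) (sqrt_iter T k - S).
  by rewrite subKr; have := Z1 k; lra.
have eqS : S = 2^-1 *r (T + S * S).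
  apply/esym/subr0_eq/(@cnorm_small _ _ _ 2) => e /hS [k [hk hk1]].
  have -> : 2^-1 *r (T + S * S) - S = (sqrt_iter T k.+1 - S) -
      2^-1 *r (sqrt_iter T k * (sqrt_iter T k - S) + (sqrt_iter T k - S) * S).
    rewrite /= mulrBr mulrBl addrA addrNK addrAC -scalerBr; congr (2^-1 *r _ - _).
    by rewrite opprB addrA addrAC addrK.
  set Z := sqrt_iter T k in hk *; apply: le_trans (cnormB _ _) _.
  rewrite cnormR ger0_norm ?half_ge0 //.
  have := cnormD (Z * (Z - S)) ((Z - S) * S).
  have := cnormM Z (Z - S); have := cnormM (Z - S) S.
  by have := Z1 k; rewrite -/Z; have := cnorm_ge0 (Z - S); nra.
have sS : star S = S.
  have sZ k : star (sqrt_iter T k) = sqrt_iter T k.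
    by elim: k => [|k IH] /=; rewrite ?star0 // starR starD starM IH sT.
  apply/subr0_eq/(@cnorm_small _ _ _ 2) => e /hS [k [hk _]].
  rewrite -(subrKA (sqrt_iter T k)) -{1}(sZ k) -starB.
  apply: le_trans (cnormD _ _) _; rewrite cnorm_starE cnorm_distC; lra.
exists (1 - S); split.
- exact: selfadjB (@selfadj1 _ _) sS.
- have eq2 : S + S = T + S * S by rewrite -rscale2 {1}eqS rscaleK ?pnatr_eq0.
  by rewrite mulrBr mulr1 mulrBl mul1r -addrA -opprD [S + _]addrA eq2 addrK.
- by rewrite subKr.
- move=> b bT.
  have bZ k : b * sqrt_iter T k = sqrt_iter T k * b.
    elim: k => [|k IH] /=; first by rewrite mulr0 mul0r.
    by rewrite -scalerAr -scalerAl mulrDr mulrDl mulrA IH -mulrA IH mulrA bT.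
  rewrite mulrBr mulrBl mulr1 mul1r; congr (_ - _).
  apply/subr0_eq/(@cnorm_small _ _ _ (2 * cnorm b)) => e /hS [k [hk _]].
  have -> : b * S - S * b = (sqrt_iter T k - S) * b - b * (sqrt_iter T k - S).
    by rewrite mulrBr mulrBl bZ opprB [RHS]addrC subrKA.
  set Z := sqrt_iter T k in hk *; apply: le_trans (cnormB _ _) _.
  have := cnormM (Z - S) b; have := cnormM b (Z - S).
  by have := cnorm_ge0 b; nra.
Qed.

End SquareRoot.

(** * Positive elements *)

Section Positive.
Context {R : realType} {A : cstarAlgType R}.
Implicit Types (r s c : R) (a b h w x y z : A).

(** Positivity expressed by the norm. In this form the closure under sums is
    the triangle inequality; [cstar_posE] below identifies it with the
    elements [y^* y]. *)
Definition psd a := selfadj a /\ exists2 c : R, 0 <= c & cnorm (c *r 1 - a) <= c.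

Lemma scalar_mull r x : (r *r 1) * x = r *r x.
Proof. by rewrite -scalerAl mul1r. Qed.

Lemma scalar_mulr r x : x * (r *r 1) = r *r x.
Proof. by rewrite -scalerAr mulr1. Qed.

Lemma psd_selfadj a : psd a -> selfadj a. Proof. by case. Qed.

Lemma psd0 : psd 0.
Proof. by split; [exact: selfadj0 | exists 0; rewrite ?rscale0 ?subrr ?cnorm0]. Qed.

Lemma psdD a b : psd a -> psd b -> psd (a + b).
Proof.
move=> [sa [c c0 ac]] [sb [d d0 bd]]; split; first exact: selfadjD.
exists (c + d); first exact: addr_ge0.
rewrite rscaleDl opprD addrACA; apply: le_trans (cnormD _ _) _; lra.
Qed.

Lemma psdR r a : 0 <= r -> psd a -> psd (r *r a).
Proof.
move=> r0 [sa [c c0 ac]]; split; first exact: selfadjR.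
exists (r * c); first exact: mulr_ge0.
by rewrite -rscaleA -scalerBr cnormR ger0_norm // ler_wpM2l.
Qed.

Lemma psd_scalar r : 0 <= r -> psd (r *r 1).
Proof.
by move=> r0; split; [exact: selfadj_scalar | exists r; rewrite ?subrr ?cnorm0].
Qed.

Lemma psd1 : psd 1.
Proof. by rewrite -[1]rscale1; apply: psd_scalar. Qed.

Lemma psd_sum (I : Type) (s : seq I) (P : pred I) (F : I -> A) :
  (forall i, P i -> psd (F i)) -> psd (\sum_(i <- s | P i) F i).
Proof. by move=> hF; elim/big_ind: _ => //; [exact: psd0 | exact: psdD]. Qed.

Lemma psd_le_norm a c : selfadj a -> cnorm a <= c -> psd (c *r 1 - a).
Proof.
move=> sa ac; split; first by apply: selfadjB => //; exact: selfadj_scalar.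
by exists c; rewrite ?subKr //; apply: le_trans (cnorm_ge0 a) ac.
Qed.

Lemma psd_ge_norm a c : selfadj a -> cnorm a <= c -> psd (c *r 1 + a).
Proof.
by move=> sa ac; rewrite -[a]opprK; apply: psd_le_norm; rewrite ?cnormN //; exact: selfadjN.
Qed.

Lemma psd_scalar_ge0 r : psd (r *r 1) -> 0 <= r.
Proof.
case=> _ [c c0]; rewrite -rscaleBl cnorm_scalar => h.
by have := ler_norm (c - r); lra.
Qed.

(** [a = c (1 - T)] with [T = 1 - a / c] of norm at most 1. *)
Lemma psd_sqrt a : psd a -> exists w : A,
  [/\ selfadj w, psd w, w * w = a & forall b, b * a = a * b -> b * w = w * b].
Proof.
move=> [sa [c c0 ac]]; have [c00|cN0] := eqVneq c 0.
  exists 0; split; [exact: selfadj0 | exact: psd0 | | by move=> b; rewrite mulr0 mul0r].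
  rewrite mulr0; apply/esym/cnorm_eq0/eqP; rewrite eq_le cnorm_ge0 andbT.
  by move: ac; rewrite c00 rscale0 sub0r cnormN.
have cp : 0 < c by rewrite lt_def cN0.
set T := c^-1 *r (c *r 1 - a).
have T1 : cnorm T <= 1.
  by rewrite cnormR ger0_norm ?invr_ge0 // mulrC ler_pdivrMr // mul1r.
have sT : selfadj T by apply/selfadjR/selfadjB => //; exact: selfadj_scalar.
have aT : c *r (1 - T) = a by rewrite scalerBr rscaleK // subKr.
have [w [sw ww w1 cw]] := sqrt_one_sub sT T1.
exists (Num.sqrt c *r w); split.
- exact: selfadjR.
- split; first exact: selfadjR.
  exists (Num.sqrt c); first exact: sqrtr_ge0.
  rewrite -scalerBr cnormR ger0_norm ?sqrtr_ge0 //.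
  by rewrite -[leRHS]mulr1 ler_wpM2l ?sqrtr_ge0.
- by rewrite -scalerAl -scalerAr rscaleA -expr2 sqr_sqrtr // ww.
- move=> b ba; rewrite -scalerAl -scalerAr cw //.
  by rewrite -scalerAl -scalerAr mulrBr mulrBl ba scalar_mull scalar_mulr.
Qed.

(** With [|w| <= 1] and [v^2 = 1 - w^2] one has [v^2 + w^2 = 1], so that
    [v + iw] is unitary and [|1 - w^2| = |v|^2 <= 1]. *)
Lemma psd_sqr w : selfadj w -> psd (w * w).
Proof.
move=> sw; have [->|w0] := eqVneq w 0; first by rewrite mulr0; exact: psd0.
have n0 : 0 < cnorm w.
  by rewrite lt_def cnorm_ge0 andbT; apply: contra_neq w0; exact: cnorm_eq0.
set u := (cnorm w)^-1 *r w.
have su : selfadj u by exact: selfadjR.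
have nu : cnorm (u * u) = 1.
  rewrite cnorm_sqr // cnormR ger0_norm ?invr_ge0 ?cnorm_ge0 //.
  by rewrite mulVf ?expr1n // gt_eqF.
have [||v [sv vv _ cv]] := @sqrt_one_sub _ _ (u * u); rewrite ?nu //.
  exact: selfadj_sqr.
have uv : u * v = v * u by apply: cv; rewrite mulrA.
have nv : cnorm v ^+ 2 <= 1.
  by rewrite -[leRHS]normr1; apply: (cnorm_sqD sv su); rewrite ?uv // vv subrK rscale1.
split; first exact: selfadj_sqr.
exists (cnorm w ^+ 2); first exact: sqr_ge0.
have -> : w * w = (cnorm w ^+ 2) *r (u * u).
  rewrite -scalerAl -scalerAr !rscaleA -[LHS]rscale1; congr (_%:C%C *: _).
  by field; rewrite gt_eqF.
rewrite -scalerBr cnormR ger0_norm ?sqr_ge0 // -vv cnorm_sqr //.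
by rewrite -[leRHS]mulr1 ler_wpM2l ?sqr_ge0.
Qed.

(** The same trick as in [psd_sqr] for the square roots of [a] and [c - a]. *)
Lemma psd_cnorm_le a c : psd a -> psd (c *r 1 - a) -> cnorm a <= c.
Proof.
move=> pa pca; have [w [sw _ ww cw]] := psd_sqrt pa.
have [v [sv _ vv cv]] := psd_sqrt pca.
have c0 : 0 <= c by apply: psd_scalar_ge0; rewrite -(subrK a (c *r 1)); exact: psdD.
have wa : w * a = a * w by rewrite -ww mulrA.
have wv : w * v = v * w.
  by apply: cv; rewrite mulrBr mulrBl wa scalar_mull scalar_mulr.
rewrite -ww cnorm_sqr // -(ger0_norm c0); apply: (cnorm_sqD sw sv wv).
by rewrite ww vv addrC subrK.
Qed.

Lemma psd_anti a : psd a -> psd (- a) -> a = 0.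
Proof.
move=> pa pna; apply/cnorm_eq0/eqP; rewrite eq_le cnorm_ge0 andbT.
by apply: psd_cnorm_le => //; rewrite rscale0 sub0r.
Qed.

Lemma psdM a b : psd a -> psd b -> a * b = b * a -> psd (a * b).
Proof.
move=> pa pb ab; have [w [sw _ ww cw]] := psd_sqrt pa.
have [v [sv _ vv cv]] := psd_sqrt pb.
have wb : w * b = b * w by apply/esym/cw.
have wv : w * v = v * w by exact: cv.
have -> : a * b = (w * v) * (w * v) by rewrite mulrA -(mulrA w v) -wv mulrA ww -mulrA vv.
by apply/psd_sqr/selfadjM.
Qed.

Lemma sqr_eq0_sa a : selfadj a -> a * a = 0 -> a = 0.
Proof.
move=> sa aa; apply/cnorm_eq0/eqP.
by have := cnorm_sqr sa; rewrite aa cnorm0 => /eqP; rewrite eq_sym sqrf_eq0.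
Qed.

Lemma starM_eq0 x : star x * x = 0 -> x = 0.
Proof.
move=> xx; apply/cnorm_eq0/eqP.
by have := cnorm_star x; rewrite xx cnorm0 => /eqP; rewrite eq_sym sqrf_eq0.
Qed.

(** [n] is the absolute value of [h] and [m = n - h] is twice its negative
    part.  The identity [h m = - n m] is all that the sequel needs of the
    decomposition of [h] into a positive and a negative part. *)
Lemma abs_exists h : selfadj h -> exists n : A,
  [/\ psd n, selfadj (n - h), h * (n - h) = - (n * (n - h)),
      n * (n - h) = (n - h) * n & forall b, b * h = h * b -> b * (n - h) = (n - h) * b].
Proof.
move=> sh; have [n [sn pn nn cn]] := psd_sqrt (psd_sqr sh).
have hn : h * n = n * h by apply: cn; rewrite mulrA.
exists n; split => //; first exact: selfadjB.
- by rewrite !mulrBr hn nn opprB.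
- by rewrite mulrBr mulrBl hn.
- by move=> b bh; rewrite mulrBr mulrBl bh cn // mulrA bh -mulrA bh mulrA.
Qed.

(** For [m = n - h], [m^2 = n m - h m = 2 n m] and so [m^4 = 2 (n m^2) m]. *)
Lemma neg_part_eq0 h n : psd n -> selfadj (n - h) ->
  h * (n - h) = - (n * (n - h)) -> n * (n - h) = (n - h) * n ->
  n * ((n - h) * (n - h)) = 0 -> h = n.
Proof.
set m := n - h => pn sm hm nm nmm.
have mm : m * m = 2 *r (n * m).
  by rewrite rscale2 {1}/m mulrBl hm opprK.
have m0 : (m * m) * (m * m) = 0.
  by rewrite {1}mm -scalerAl mulrA -(mulrA n) nmm mul0r scaler0.
have := sqr_eq0_sa (selfadj_sqr sm) m0.
by move/(sqr_eq0_sa sm)/subr0_eq.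
Qed.

Lemma bernoulli x k : psd x -> psd ((1 + x) ^+ k - (1 + k%:R *r x)).
Proof.
move=> px; elim: k => [|k IH].
  by rewrite expr0 rscale0 addr0 subrr; exact: psd0.
set y := (1 + x) ^+ k in IH *.
have xy : GRing.comm x y by apply/commrX/commrD; [exact: commr1|].
have -> : (1 + x) ^+ k.+1 - (1 + k.+1%:R *r x) =
    (1 + x) * (y - (1 + k%:R *r x)) + k%:R *r (x * x).
  rewrite exprS -/y mulrBr -addrA; congr (_ + _).
  rewrite mulrDr mulr1 mulrDl mul1r -scalerAr !opprD -!addrA addNr addr0.
  by rewrite -natr1 rscaleDl rscale1 opprD [- x + _]addrC.
apply: psdD; last by apply: psdR; [exact: ler0n | exact/psd_sqr/psd_selfadj].
apply: psdM => //; first by apply: psdD => //; exact: psd1.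
have xx : GRing.comm x (k%:R *r x) by rewrite /GRing.comm -scalerAl -scalerAr.
have xw : GRing.comm x (y - (1 + k%:R *r x)).
  by apply: commrB => //; apply: commrD => //; exact: commr1.
by apply/commr_sym/commrD; [exact: commr1 | exact: commr_sym].
Qed.

(** With [s = - z^* z] one has [z^* (1 - z z^* )^k z = - (1 + s)^k s].  The left
    side stays bounded in [k], because [0 <= z z^* <= 1], while the norm of the
    right side is at least [k |s^2|]. *)
Lemma opposite_starM_eq0 z (s t : A) : psd s -> psd t ->
  star z * z = - s -> z * star z = t -> cnorm z <= 1 -> s = 0.
Proof.
move=> ps pt zz zzs z1; have ss := psd_selfadj ps.
have t1 : cnorm (1 - t) <= 1.
  rewrite -[X in X - t]rscale1; apply: psd_cnorm_le; last by rewrite subKr.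
  apply: psd_le_norm; first exact: psd_selfadj.
  by rewrite -zzs (le_trans (cnormM _ _)) // cnorm_starE mulr_ile1 ?cnorm_ge0.
have t1X k : cnorm ((1 - t) ^+ k) <= 1.
  elim: k => [|k IH]; first by rewrite expr0 cnorm1.
  by rewrite exprS (le_trans (cnormM _ _)) // mulr_ile1 ?cnorm_ge0.
have key k : (1 + s) ^+ k * s = - (star z * (1 - t) ^+ k * z).
  have -> : star z * (1 - t) ^+ k = (1 + s) ^+ k * star z.
    elim: k => [|k IH]; first by rewrite !expr0 mulr1 mul1r.
    rewrite exprSr mulrA IH exprSr -!mulrA; congr (_ * _).
    by rewrite mulrBr mulrDl mulr1 mul1r -zzs mulrA zz mulNr opprK.
  by rewrite -mulrA zz mulrN opprK.
have bd k : cnorm ((1 + s) ^+ k * s) <= 1.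
  rewrite key cnormN (le_trans (cnormM _ _)) // mulr_ile1 ?cnorm_ge0 //.
  by rewrite (le_trans (cnormM _ _)) // mulr_ile1 ?cnorm_ge0 ?cnorm_starE.
have ge k : k%:R * cnorm (s * s) <= 1.
  have ck : (1 + s) ^+ k * s = s * (1 + s) ^+ k.
    by apply/commr_sym/commrX/commrD; [exact: commr1|].
  rewrite -[k%:R]ger0_norm ?ler0n // -cnormR; apply: psd_cnorm_le.
    by apply: psdR; [exact: ler0n | exact: psd_sqr].
  have -> : 1 *r 1 - k%:R *r (s * s) = (1 *r 1 - (1 + s) ^+ k * s) +
      (((1 + s) ^+ k - (1 + k%:R *r s)) * s + s).
    rewrite mulrBl mulrDl mul1r -scalerAl opprD -!addrA; congr (_ + _).
    by rewrite addKr addrCA addNr addr0.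
  apply: psdD.
    apply: psd_le_norm => //; apply: selfadjM => //.
    rewrite /selfadj; elim: {ck} k => [|k IH]; first by rewrite expr0 star1.
    by rewrite exprS starM starD star1 IH ss -exprSr exprS.
  apply: psdD => //; apply: psdM => //; first exact: bernoulli.
  rewrite mulrBl mulrBr ck; congr (_ - _).
  by rewrite mulrDl mulrDr mul1r mulr1 -scalerAl -scalerAr.
apply: sqr_eq0_sa => //; apply/cnorm_eq0/eqP; rewrite eq_le cnorm_ge0 andbT.
rewrite leNgt; apply/negP => p; have := ge (Num.truncn (cnorm (s * s))^-1).+1.
apply/negP; rewrite -ltNge -ltr_pdivrMr // div1r.
exact: Num.Theory.truncnS_gt.
Qed.

(** The theorem of Kelley and Vaught.  With [m] twice the negative part of
    [h = y^* y], the element [z = y m] satisfies [z^* z = m h m <= 0], hence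
    [z z^* >= 0] because [z^* z + z z^*] is a sum of squares of self-adjoint
    elements; so [z = 0] and [m = 0]. *)
Theorem psd_starM y : psd (star y * y).
Proof.
set h := star y * y; have sh : selfadj h by exact: selfadj_starM.
have [n [pn sm hm nm _]] := abs_exists sh; set m := n - h in sm hm nm.
set r := (cnorm (y * m) + 1)^-1; set z := r *r (y * m).
have n1 : 0 < cnorm (y * m) + 1 by rewrite ltr_wpDl ?cnorm_ge0.
have r0 : 0 < r by rewrite invr_gt0.
have z1 : cnorm z <= 1.
  rewrite cnormR ger0_norm ?(ltW r0) // mulrC ler_pdivrMr // mul1r; lra.
set s := (r * r) *r (n * (m * m)).
have ps : psd s.
  apply: psdR; first by rewrite mulr_ge0 ?ltW.
  by apply: psdM => //; [exact: psd_sqr | rewrite mulrA nm -mulrA nm mulrA].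
have zz : star z * z = - s.
  rewrite /z starR starM sm -scalerAl -scalerAr rscaleA -scalerN; congr (_ *: _).
  by rewrite -mulrA [star y * _]mulrA -/h hm mulrN !mulrA nm.
have pt : psd (z * star z).
  set a := rpart z; set b := ipart z.
  have sa : selfadj a by exact: selfadj_rpart.
  have sb : selfadj b by exact: selfadj_ipart.
  have -> : z * star z = 2 *r (a * a + b * b) + s.
    apply/(addIr (- s)); rewrite addrK -zz [in X in _ + X](ri_partE z).
    rewrite {1 2}(ri_partE z) -/a -/b Mstar_ri // starM_ri //.
    by rewrite addrACA addNr addr0 rscale2.
  by apply: psdD => //; apply: psdR => //; apply: psdD; exact: psd_sqr.
have := opposite_starM_eq0 ps pt zz erefl z1.
move/(congr1 (fun x => (r * r)^-1 *r x)); rewrite scaler0 rscaleVK; last first.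
  by rewrite mulf_neq0 ?gt_eqF.
by move/(neg_part_eq0 pn sm hm nm) ->.
Qed.

Lemma cstar_posE a : cstar_pos a <-> psd a.
Proof.
split=> [[y ->]|/psd_sqrt[w [sw _ ww _]]]; first exact: psd_starM.
by exists w; rewrite sw ww.
Qed.

Lemma psd_conj y a : psd a -> psd (star y * a * y).
Proof.
move=> /psd_sqrt[w [sw _ <- _]].
by rewrite -mulrA -{1}sw -!mulrA mulrA -starM; exact: psd_starM.
Qed.

End Positive.

(** * Order, star homomorphisms and unital isometries *)

Section Order.
Context {R : realType} {A : cstarAlgType R}.
Implicit Types (r s c : R) (a b h x y z : A).

Lemma cstar_leE x y : cstar_le x y <-> psd (y - x).
Proof. exact: cstar_posE. Qed.

Lemma psdD_eq0 a b : psd a -> psd b -> a + b = 0 -> a = 0.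
Proof.
move=> pa pb /eqP; rewrite addrC addr_eq0 => /eqP ba; apply: psd_anti => //.
by rewrite -ba.
Qed.

Lemma psd_sum_eq0 (I : finType) (F : I -> A) :
  (forall i, psd (F i)) -> \sum_i F i = 0 -> forall i, F i = 0.
Proof.
move=> pF F0 i; apply: (@psdD_eq0 _ (\sum_(j | j != i) F j)) => //.
  by apply: psd_sum.
by move: F0; rewrite (bigD1 i).
Qed.

Lemma cnorm_le_psd x c : 0 <= c ->
  cnorm x <= c <-> psd ((c ^+ 2) *r 1 - star x * x).
Proof.
move=> c0; split=> [xc|p].
  apply: psd_le_norm; first exact: selfadj_starM.
  by rewrite cnorm_star ler_pXn2r ?nnegrE ?cnorm_ge0.
have := psd_cnorm_le (psd_starM x) p.
by rewrite cnorm_star ler_pXn2r ?nnegrE ?cnorm_ge0.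
Qed.

(** [c^2 - a^2] is the product of the commuting positive elements [c - a] and
    [c + a]. *)
Lemma psd_pm_cnorm a c : psd (c *r 1 - a) -> psd (c *r 1 + a) -> cnorm a <= c.
Proof.
move=> pm pp.
have c0 : 0 <= c.
  have : psd ((2 * c) *r (1 : A)).
    rewrite -rscaleA rscale2 -[X in X + _](subrK a) -addrA [a + _]addrC.
    exact: psdD.
  by move/psd_scalar_ge0; lra.
have sa : selfadj a.
  by rewrite -(addKr (c *r 1) a) addrC; apply: selfadjB;
     [exact: psd_selfadj | exact: selfadj_scalar].
apply/cnorm_le_psd => //; rewrite sa.
have -> : (c ^+ 2) *r 1 - a * a = (c *r 1 - a) * (c *r 1 + a).
  rewrite mulrBl !mulrDr !scalar_mull scalar_mulr rscaleA -expr2 opprD addrA.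
  by rewrite addrK.
apply: psdM => //.
have ca : GRing.comm (c *r 1) a by rewrite /GRing.comm scalar_mull scalar_mulr.
apply: commrD; apply/commr_sym/commrB => //; exact/commr_sym.
Qed.

Lemma selfadj_psdB a : selfadj a ->
  exists c : R, psd (c *r (1 : A)) /\ psd (c *r 1 - a).
Proof.
move=> sa; exists (cnorm a); split; last exact: psd_le_norm.
exact/psd_scalar/cnorm_ge0.
Qed.

End Order.

Section UnitalMaps.
Context {R : realType} {A B : cstarAlgType R}.
Implicit Types (phi j : A -> B).

Definition unital_linear phi : Prop :=
  (forall (a : R[i]) x y, phi (a *: x + y) = a *: phi x + phi y) /\ phi 1 = 1.

Section Linear.
Variable phi : A -> B.
Hypothesis phi_lin : unital_linear phi.

Lemma ulin1 : phi 1 = 1. Proof. by case: phi_lin. Qed.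
Lemma ulinD x y : phi (x + y) = phi x + phi y.
Proof. by case: phi_lin => h _; rewrite -[x]scale1r h !scale1r. Qed.
Lemma ulin0 : phi 0 = 0.
Proof. by apply: (addrI (phi 0)); rewrite -ulinD !addr0. Qed.
Lemma ulinZ a x : phi (a *: x) = a *: phi x.
Proof. by case: phi_lin => h _; rewrite -[a *: x]addr0 h ulin0 addr0. Qed.
Lemma ulinN x : phi (- x) = - phi x.
Proof. by rewrite -scaleN1r ulinZ scaleN1r. Qed.
Lemma ulinB x y : phi (x - y) = phi x - phi y.
Proof. by rewrite ulinD ulinN. Qed.
Lemma ulin_scalar (r : R) : phi (r *r 1) = r *r 1.
Proof. by rewrite ulinZ ulin1. Qed.

(** A self-adjoint element is a difference of positive ones. *)
Lemma positive_selfadj : (forall x, psd x -> psd (phi x)) ->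
  forall x, selfadj x -> selfadj (phi x).
Proof.
move=> pphi x /selfadj_psdB[c [pc pcx]].
rewrite -(subKr (c *r 1) x) ulinB.
by apply: selfadjB; apply: psd_selfadj; apply: pphi.
Qed.

End Linear.

Definition star_hom j : Prop :=
  [/\ unital_linear j, forall x y, j (x * y) = j x * j y &
      forall x, j (star x) = star (j x)].

Lemma star_hom_psd j a : star_hom j -> psd a -> psd (j a).
Proof.
move=> [_ jM js] /psd_sqrt[w [sw _ <- _]]; rewrite jM.
by apply: psd_sqr; rewrite /selfadj -js sw.
Qed.

(** For [m] twice the negative part of [h], the element [- m h m] is positive
    and its image is both positive and negative; so [m = 0]. *)
Lemma star_hom_reflect j h : star_hom j -> (forall x, j x = 0 -> x = 0) ->
  selfadj h -> psd (j h) -> psd h.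
Proof.
move=> hj j_inj sh pjh; have [jl jM js] := hj.
have [n [pn sm hm nm _]] := abs_exists sh; set m := n - h in sm hm nm.
have mhm : m * h * m = - (n * (m * m)).
  by rewrite -mulrA hm mulrN !mulrA nm.
have pnmm : psd (n * (m * m)).
  by apply: psdM => //; [exact: psd_sqr | rewrite mulrA nm -mulrA nm mulrA].
suff nmm : n * (m * m) = 0 by rewrite (neg_part_eq0 pn sm hm nm nmm).
apply/j_inj/psd_anti; first exact: star_hom_psd.
rewrite -(ulinN jl) -mhm !jM -{1}sm js; exact: psd_conj.
Qed.

(** [|x| <= c] is the positivity of [c^2 - x^* x], which [j] preserves and
    reflects. *)
Lemma star_hom_cnorm j x : star_hom j -> (forall y, j y = 0 -> y = 0) ->
  cnorm (j x) = cnorm x.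
Proof.
move=> hj j_inj; have [jl jM js] := hj.
have jE c : j (c *r 1 - star x * x) = c *r 1 - star (j x) * j x.
  by rewrite (ulinB jl) (ulin_scalar jl) jM js.
apply/eqP; rewrite eq_le; apply/andP; split.
  apply/(cnorm_le_psd _ (cnorm_ge0 x)); rewrite -jE; apply: star_hom_psd => //.
  exact/(cnorm_le_psd _ (cnorm_ge0 x)).
apply/(cnorm_le_psd _ (cnorm_ge0 _)); apply: (star_hom_reflect hj j_inj).
  by apply: selfadjB; [exact: selfadj_scalar | exact: selfadj_starM].
by rewrite jE; exact/(cnorm_le_psd _ (cnorm_ge0 _)).
Qed.

Section UnitalIsometry.
Variable phi : A -> B.
Hypothesis phi_lin : unital_linear phi.
Hypothesis phi_iso : forall x, cnorm (phi x) = cnorm x.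

(** If [b] is the imaginary part of [phi h], then
    [|b + t|^2 <= |h + it|^2 <= |h|^2 + t^2] for every real [t], which leaves no
    room for the term [2tb]. *)
Lemma unital_isometry_selfadj h : selfadj h -> selfadj (phi h).
Proof.
move=> sh; set a := rpart (phi h); set b := ipart (phi h).
have sa : selfadj a by exact: selfadj_rpart.
have sb : selfadj b by exact: selfadj_ipart.
have bt t : psd ((cnorm h ^+ 2) *r 1 - (2 * t) *r b).
  set u := h + 'i%C *: (t *r 1).
  have nu : cnorm u ^+ 2 <= cnorm h ^+ 2 + t ^+ 2.
    rewrite -cnorm_star starM_ri //; last exact: selfadj_scalar.
    rewrite !scalar_mull scalar_mulr subrr scaler0 addr0 rscaleA -expr2.
    apply: le_trans (cnormD _ _) _; rewrite cnorm_sqr // cnorm_scalar.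
    by rewrite ger0_norm ?sqr_ge0.
  have phiu : phi u = a + 'i%C *: (b + t *r 1).
    rewrite /u (ulinD phi_lin) (ulinZ phi_lin) (ulin_scalar phi_lin).
    by rewrite [phi h]ri_partE scalerDr addrA.
  have sbt : selfadj (b + t *r 1) by apply: selfadjD => //; exact: selfadj_scalar.
  have nbt : cnorm ((b + t *r 1) * (b + t *r 1)) <= cnorm h ^+ 2 + t ^+ 2.
    rewrite cnorm_sqr //; apply: le_trans nu.
    rewrite ler_pXn2r ?nnegrE ?cnorm_ge0 //.
    by rewrite -(ipart_ri sa sbt) -phiu -(phi_iso u) cnorm_ipart.
  have -> : (cnorm h ^+ 2) *r 1 - (2 * t) *r b =
    ((cnorm h ^+ 2 + t ^+ 2) *r 1 - (b + t *r 1) * (b + t *r 1)) + b * b.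
    have -> : (b + t *r 1) * (b + t *r 1) = b * b + (2 * t) *r b + (t ^+ 2) *r 1.
      rewrite -(rscaleA 2) rscale2 expr2 -(rscaleA t).
      by rewrite [LHS]mulrDl [b * _]mulrDr [_ * (b + _)]mulrDr !scalar_mull
        scalar_mulr !addrA.
    by rewrite rscaleDl opprD addrACA subrr addr0 opprD [- _ - _]addrC addrA subrK.
  apply: psdD; last exact: psd_sqr.
  by apply: psd_le_norm => //; exact: selfadj_sqr.
suff b0 : b = 0 by rewrite (ri_partE (phi h)) -/a -/b b0 scaler0 addr0.
apply: (@cnorm_small _ _ _ (cnorm h ^+ 2 / 2)) => e e0.
have : cnorm ((2 * e^-1) *r b) <= cnorm h ^+ 2.
  apply: psd_pm_cnorm => //.
  by rewrite -[_ *r b]opprK -rscaleNl -mulrN; exact: bt.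
rewrite cnormR ger0_norm; last by rewrite mulr_ge0 ?invr_ge0 ?ltW.
by rewrite mulrAC ler_pdivrMr //; lra.
Qed.

(** The norm estimate which defines positivity is preserved in both directions;
    an [h] with self-adjoint image is itself self-adjoint because [phi] maps its
    imaginary part to that of [phi h]. *)
Lemma unital_isometry_psd h : psd h <-> psd (phi h).
Proof.
have eqn c : cnorm (c *r 1 - phi h) = cnorm (c *r 1 - h).
  by rewrite -(ulin_scalar phi_lin) -(ulinB phi_lin) phi_iso.
split=> -[sh [c c0 hc]]; split.
- exact: unital_isometry_selfadj.
- by exists c; rewrite ?eqn.
- set a := rpart h; set b := ipart h.
  have sa : selfadj (phi a) by exact/unital_isometry_selfadj/selfadj_rpart.
  have sb : selfadj (phi b) by exact/unital_isometry_selfadj/selfadj_ipart.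
  have pb : phi b = 0.
    rewrite -(ipart_ri sa sb) -(ulinZ phi_lin) -(ulinD phi_lin) -ri_partE.
    exact: ipart_sa.
  suff b0 : b = 0.
    by rewrite (ri_partE h) -/b b0 scaler0 addr0; exact: selfadj_rpart.
  by apply/cnorm_eq0; rewrite -phi_iso pb cnorm0.
- by exists c; rewrite -?eqn.
Qed.

End UnitalIsometry.

End UnitalMaps.

(** * Matrices over a C*-algebra *)

Section MatrixStar.
Context {R : realType} {A : cstarAlgType R}.

Lemma starmxE m n (X : 'M[A]_(m, n)) i j : starmx X i j = star (X j i).
Proof. by rewrite !mxE. Qed.

Lemma starmxK m n : cancel (@starmx R A m n) (@starmx R A n m).
Proof. by move=> X; apply/matrixP => i j; rewrite !starmxE starK. Qed.

Lemma starmx_mul m n p (X : 'M[A]_(m, n)) (Y : 'M[A]_(n, p)) :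
  starmx (X *m Y) = starmx Y *m starmx X.
Proof.
apply/matrixP => i j; rewrite starmxE !mxE star_sum.
by apply: eq_bigr => k _; rewrite starM !starmxE.
Qed.

Lemma starmxD m n (X Y : 'M[A]_(m, n)) : starmx (X + Y) = starmx X + starmx Y.
Proof. by apply/matrixP => i j; rewrite !mxE starD. Qed.

(** Multiplication of a matrix by a complex scalar: the scaling of ['M[A]_n]
    is by elements of [A]. *)
Definition cscale m n (a : R[i]) (X : 'M[A]_(m, n)) : 'M[A]_(m, n) :=
  map_mx ( *:%R a) X.

Lemma cscale_mull m n p (a : R[i]) (X : 'M[A]_(m, n)) (Y : 'M[A]_(n, p)) :
  cscale a (X *m Y) = cscale a X *m Y.
Proof.
apply/matrixP => i j; rewrite !mxE scaler_sumr.
by apply: eq_bigr => k _; rewrite !mxE scalerAl.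
Qed.

Lemma cscale_mulr m n p (a : R[i]) (X : 'M[A]_(m, n)) (Y : 'M[A]_(n, p)) :
  cscale a (X *m Y) = X *m cscale a Y.
Proof.
apply/matrixP => i j; rewrite !mxE scaler_sumr.
by apply: eq_bigr => k _; rewrite !mxE scalerAr.
Qed.

Lemma starmx_cscale m n (a : R[i]) (X : 'M[A]_(m, n)) :
  starmx (cscale a X) = cscale (conjc a) (starmx X).
Proof. by apply/matrixP => i j; rewrite !mxE starZ. Qed.

Lemma cscaleA m n (a b : R[i]) (X : 'M[A]_(m, n)) :
  cscale a (cscale b X) = cscale (a * b) X.
Proof. by apply/matrixP => i j; rewrite !mxE scalerA. Qed.

Lemma cscale1 m n (X : 'M[A]_(m, n)) : cscale 1 X = X.
Proof. by apply/matrixP => i j; rewrite !mxE scale1r. Qed.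

Lemma cscaleDr m n (a : R[i]) (X Y : 'M[A]_(m, n)) :
  cscale a (X + Y) = cscale a X + cscale a Y.
Proof. by apply/matrixP => i j; rewrite !mxE scalerDr. Qed.

Lemma cscaleDl m n (X : 'M[A]_(m, n)) (a b : R[i]) :
  cscale (a + b) X = cscale a X + cscale b X.
Proof. by apply/matrixP => i j; rewrite !mxE scalerDl. Qed.

End MatrixStar.

Section HilbertModule.
Context {R : realType} {A : cstarAlgType R} {n : nat}.
Implicit Types (v w : 'cV[A]_n) (X Y : 'M[A]_n).

(** The [A]-valued inner product of A^n. *)
Definition inner v w : A := (starmx v *m w) ord0 ord0.

Lemma innerE v w : inner v w = \sum_i star (v i ord0) * w i ord0.
Proof. by rewrite /inner mxE; apply: eq_bigr => i _; rewrite starmxE. Qed.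

Lemma psd_inner v : psd (inner v v).
Proof. by rewrite innerE; apply: psd_sum => i _; exact: psd_starM. Qed.

Lemma star_inner v w : star (inner v w) = inner w v.
Proof. by rewrite /inner -starmxE starmx_mul starmxK. Qed.

Lemma inner_adj X v w : inner (X *m v) w = inner v (starmx X *m w).
Proof. by rewrite /inner starmx_mul mulmxA. Qed.

Lemma innerDr v w w' : inner v (w + w') = inner v w + inner v w'.
Proof. by rewrite /inner mulmxDr mxE. Qed.

Lemma innerDl v v' w : inner (v + v') w = inner v w + inner v' w.
Proof. by rewrite -star_inner innerDr starD !star_inner. Qed.

Lemma innerZr (a : R[i]) v w : inner v (cscale a w) = a *: inner v w.
Proof. by rewrite /inner -cscale_mulr mxE. Qed.

Lemma innerZl (a : R[i]) v w : inner (cscale a v) w = conjc a *: inner v w.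
Proof. by rewrite -star_inner innerZr starZ star_inner. Qed.

Lemma colnorm_ge0 v : 0 <= colnorm v. Proof. exact: sqrtr_ge0. Qed.

Lemma colnorm_sqr v : colnorm v ^+ 2 = cnorm (inner v v).
Proof. by rewrite sqr_sqrtr ?cnorm_ge0. Qed.

Lemma colnormZ (a : R[i]) v :
  colnorm (cscale a v) = ComplexField.Normc.normc a * colnorm v.
Proof.
have nZ : 0 <= ComplexField.Normc.normc a by case: a => p q; exact: sqrtr_ge0.
apply/eqP; rewrite -(@eqrXn2 _ 2) ?mulr_ge0 ?colnorm_ge0 // exprMn !colnorm_sqr.
rewrite innerZr innerZl !cnormZ mulrA expr2; apply/eqP; congr (_ * _ * _).
by case: a {nZ} => p q /=; rewrite sqrrN.
Qed.

Lemma colnormR (r : R) v : colnorm (cscale (r%:C)%C v) = `|r| * colnorm v.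
Proof. by rewrite colnormZ /= expr0n /= addr0 sqrtr_sqr. Qed.

Lemma cnorm_entry v i : cnorm (v i ord0) <= colnorm v.
Proof.
apply/cnorm_le_psd; first exact: colnorm_ge0.
rewrite colnorm_sqr -(subrKA (inner v v)); apply: psdD.
  exact/psd_le_norm/lexx/psd_selfadj/psd_inner.
rewrite innerE (bigD1 i) //= addrAC subrr add0r.
by apply: psd_sum => k _; exact: psd_starM.
Qed.

Lemma colnorm_le_sum v : colnorm v <= \sum_i cnorm (v i ord0).
Proof.
have s0 : 0 <= \sum_i cnorm (v i ord0) by apply: sumr_ge0 => i _; exact: cnorm_ge0.
rewrite -(@ler_pXn2r _ 2) ?nnegrE ?colnorm_ge0 // colnorm_sqr innerE.
apply: (@le_trans _ _ (\sum_i cnorm (v i ord0) ^+ 2)).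
  apply: (big_ind2 (fun (x : A) (y : R) => cnorm x <= y)).
  - by rewrite cnorm0.
  - by move=> x1 x2 y1 y2 h1 h2; apply: le_trans (cnormD _ _) _; exact: lerD.
  - by move=> i _; rewrite cnorm_star.
rewrite [leRHS]expr2 mulr_suml; apply: ler_sum => i _; rewrite expr2.
rewrite ler_wpM2l ?cnorm_ge0 // (bigD1 i) //= lerDl.
by apply: sumr_ge0 => k _; exact: cnorm_ge0.
Qed.

Lemma colnorm_eq0 v : colnorm v = 0 -> v = 0.
Proof.
move=> v0; apply/matrixP => i j; rewrite ord1 mxE.
by apply/cnorm_eq0/eqP; rewrite eq_le cnorm_ge0 -{1}v0 cnorm_entry.
Qed.

Lemma colnorm0 : colnorm (0 : 'cV[A]_n) = 0.
Proof.
apply/eqP; rewrite eq_le colnorm_ge0 andbT; apply: le_trans (colnorm_le_sum _) _.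
by rewrite big1 // => i _; rewrite mxE cnorm0.
Qed.

(** With [a = <v, w>] and [N = |v|^2], expand [0 <= <va - N w, va - N w>] and
    bound [<v, v>] by [N]. *)
Lemma cauchy_schwarz v w : cnorm (inner v w) <= colnorm v * colnorm w.
Proof.
have [/colnorm_eq0 ->|vN0] := eqVneq (colnorm v) 0.
  rewrite innerE big1 ?cnorm0 ?colnorm0 ?mul0r // => i _.
  by rewrite mxE star0 mul0r.
set a := inner v w; set N := colnorm v ^+ 2.
have N0 : 0 < N by rewrite exprn_gt0 // lt_def vN0 colnorm_ge0.
pose va : 'cV[A]_n := \col_i (v i ord0 * a).
have vaR x : inner x va = inner x v * a.
  by rewrite !innerE mulr_suml; apply: eq_bigr => i _; rewrite mxE mulrA.
have vaL x : inner va x = star a * inner v x.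
  by rewrite -star_inner vaR starM star_inner.
have wv : inner w v = star a by rewrite star_inner.
have p1 : psd (N *r inner w w - star a * a).
  have -> : N *r inner w w - star a * a = N^-1 *r
      (inner (va + cscale (- N)%:C%C w) (va + cscale (- N)%:C%C w) +
       star a * (N *r 1 - inner v v) * a).
    rewrite !(innerDl, innerDr, innerZl, innerZr) !(vaL, vaR) wv /= oppr0 !rscaleNl.
    rewrite scalerN opprK -/a rscaleA mulrBr mulrBl scalar_mulr -scalerAl.
    rewrite -[star a * _ * a]mulrA [X in N^-1 *r X]addrC addrA subrKA subrr add0r.
    by rewrite [X in N^-1 *r X]addrC -(rscaleA N N) -scalerBr rscaleVK // gt_eqF.
  apply: psdR; first by rewrite invr_ge0 ltW.
  apply: psdD; first exact: psd_inner.
  apply/psd_conj/psd_le_norm; last by rewrite -colnorm_sqr.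
  exact/psd_selfadj/psd_inner.
apply/cnorm_le_psd; first by rewrite mulr_ge0 ?colnorm_ge0.
rewrite -(subrKA (N *r inner w w)); apply: psdD => //.
rewrite exprMn -/N colnorm_sqr -rscaleA -scalerBr; apply: psdR; first exact: ltW.
exact/psd_le_norm/lexx/psd_selfadj/psd_inner.
Qed.

End HilbertModule.

Section MatrixNorm.
Context {R : realType} {A : cstarAlgType R} {n : nat}.
Implicit Types (v w : 'cV[A]_n) (X Y : 'M[A]_n).

Let image_ball X : set R :=
  [set colnorm (X *m v) | v in [set v : 'cV[A]_n | colnorm v <= 1]].

Lemma colnorm_mul_le_sum X v : colnorm v <= 1 ->
  colnorm (X *m v) <= \sum_i \sum_j cnorm (X i j).
Proof.
move=> v1; apply: le_trans (colnorm_le_sum _) _; apply: ler_sum => i _.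
rewrite mxE; apply: (big_ind2 (fun (x : A) (y : R) => cnorm x <= y)).
- by rewrite cnorm0.
- by move=> x1 x2 y1 y2 h1 h2; apply: le_trans (cnormD _ _) _; exact: lerD.
- move=> j _; apply: le_trans (cnormM _ _) _.
  rewrite -[leRHS]mulr1 ler_wpM2l ?cnorm_ge0 //.
  exact: le_trans (cnorm_entry v j) v1.
Qed.

Lemma image_ball_sup X : has_sup (image_ball X).
Proof.
split; first by exists (colnorm (X *m 0)), 0; rewrite //= colnorm0.
by exists (\sum_i \sum_j cnorm (X i j)) => _ [v v1 <-]; exact: colnorm_mul_le_sum.
Qed.

Lemma mxnorm_le X c : (forall v, colnorm v <= 1 -> colnorm (X *m v) <= c) ->
  cstar_mxnorm X <= c.
Proof.
move=> h; apply: ge_sup; first by case: (image_ball_sup X).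
by move=> _ [v v1 <-]; exact: h.
Qed.

Lemma mxnorm_ge0 X : 0 <= cstar_mxnorm X.
Proof.
apply: (@le_trans _ _ (colnorm (X *m 0))); first exact: colnorm_ge0.
apply: ub_le_sup; first by case: (image_ball_sup X).
by exists 0; rewrite //= colnorm0.
Qed.

Lemma mxnorm_op X v : colnorm (X *m v) <= cstar_mxnorm X * colnorm v.
Proof.
have [v0|vN0] := eqVneq (colnorm v) 0.
  by rewrite v0 (colnorm_eq0 v0) mulmx0 colnorm0 mulr0.
have vp : 0 < colnorm v by rewrite lt_def vN0 colnorm_ge0.
rewrite -ler_pdivrMr //.
have -> : colnorm (X *m v) / colnorm v = colnorm (X *m cscale ((colnorm v)^-1)%:C%C v).
  by rewrite -cscale_mulr colnormR ger0_norm ?invr_ge0 ?colnorm_ge0 // mulrC.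
apply: ub_le_sup; first by case: (image_ball_sup X).
exists (cscale ((colnorm v)^-1)%:C%C v) => //=.
by rewrite colnormR ger0_norm ?invr_ge0 ?colnorm_ge0 // mulVf.
Qed.

Lemma mxnorm_le_sum X : cstar_mxnorm X <= \sum_i \sum_j cnorm (X i j).
Proof. by apply: mxnorm_le => v; exact: colnorm_mul_le_sum. Qed.

Lemma colnormD v w : colnorm (v + w) <= colnorm v + colnorm w.
Proof.
rewrite -(@ler_pXn2r _ 2) ?nnegrE ?addr_ge0 ?colnorm_ge0 //.
rewrite colnorm_sqr innerDl !innerDr sqrrD !colnorm_sqr.
have := cauchy_schwarz v w; have := cauchy_schwarz w v.
have := cnormD (inner v v + inner v w) (inner w v + inner w w).
have := cnormD (inner v v) (inner v w); have := cnormD (inner w v) (inner w w).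
by lra.
Qed.

Lemma mxnormD X Y : cstar_mxnorm (X + Y) <= cstar_mxnorm X + cstar_mxnorm Y.
Proof.
apply: mxnorm_le => v v1; rewrite mulmxDl; apply: le_trans (colnormD _ _) _.
by have := mxnorm_op X v; have := mxnorm_op Y v;
  have := mxnorm_ge0 X; have := mxnorm_ge0 Y; nra.
Qed.

Lemma mxnorm_le_op X c : 0 <= c -> (forall v, colnorm (X *m v) <= c * colnorm v) ->
  cstar_mxnorm X <= c.
Proof.
by move=> c0 h; apply: mxnorm_le => v v1; have := h v; have := colnorm_ge0 v; nra.
Qed.

Lemma mxnormM X Y : cstar_mxnorm (X *m Y) <= cstar_mxnorm X * cstar_mxnorm Y.
Proof.
apply: mxnorm_le_op; first by rewrite mulr_ge0 ?mxnorm_ge0.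
move=> v; rewrite -mulmxA -mulrA; apply: le_trans (mxnorm_op _ _) _.
by rewrite ler_wpM2l ?mxnorm_ge0 ?mxnorm_op.
Qed.

Lemma normc_ge0 (a : R[i]) : 0 <= ComplexField.Normc.normc a.
Proof. by case: a => p q; exact: sqrtr_ge0. Qed.

Lemma mxnormZ (a : R[i]) X :
  cstar_mxnorm (cscale a X) = ComplexField.Normc.normc a * cstar_mxnorm X.
Proof.
have le (b : R[i]) Y :
    cstar_mxnorm (cscale b Y) <= ComplexField.Normc.normc b * cstar_mxnorm Y.
  apply: mxnorm_le_op; first by rewrite mulr_ge0 ?mxnorm_ge0 ?normc_ge0.
  move=> v; rewrite -cscale_mull colnormZ -mulrA ler_wpM2l ?normc_ge0 //.
  exact: mxnorm_op.
apply/eqP; rewrite eq_le le /=; have [->|a0] := eqVneq a 0.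
  by rewrite ComplexField.Normc.normc0 mul0r mxnorm_ge0.
have := le a^-1 (cscale a X); rewrite cscaleA mulVf // cscale1.
rewrite ComplexField.Normc.normcV mulrC ler_pdivlMr ?[_ * cstar_mxnorm X]mulrC //.
rewrite lt_def normc_ge0 andbT.
by apply: contra_neq a0; exact: ComplexField.Normc.eq0_normc.
Qed.

(** For [w = X^* v], [|w|^2 = <v, X w> <= |v| |X| |w|]. *)
Lemma mxnorm_star_le X : cstar_mxnorm (starmx X) <= cstar_mxnorm X.
Proof.
apply: mxnorm_le_op => [|v]; first exact: mxnorm_ge0.
set w := starmx X *m v; have [->|wN0] := eqVneq (colnorm w) 0.
  by rewrite mulr_ge0 ?mxnorm_ge0 ?colnorm_ge0.
have wp : 0 < colnorm w by rewrite lt_def wN0 colnorm_ge0.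
rewrite -(ler_pM2r wp) -expr2 colnorm_sqr {1}/w inner_adj starmxK.
apply: le_trans (cauchy_schwarz _ _) _.
rewrite [_ * colnorm v]mulrC -mulrA ler_wpM2l ?colnorm_ge0 //.
exact: mxnorm_op.
Qed.

(** [|X v|^2 = <v, X^* X v>] gives [|X|^2 <= |X^* X|]. *)
Lemma mxnorm_star X : cstar_mxnorm (starmx X *m X) = cstar_mxnorm X ^+ 2.
Proof.
apply/eqP; rewrite eq_le; apply/andP; split.
  apply: le_trans (mxnormM _ _) _; rewrite expr2 ler_wpM2r ?mxnorm_ge0 //.
  exact: mxnorm_star_le.
set N := cstar_mxnorm (_ *m _); have N0 : 0 <= N by exact: mxnorm_ge0.
rewrite -(sqr_sqrtr N0) ler_pXn2r ?nnegrE ?mxnorm_ge0 ?sqrtr_ge0 //.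
apply: mxnorm_le => v v1; rewrite -(@ler_pXn2r _ 2) ?nnegrE ?colnorm_ge0 ?sqrtr_ge0 //.
rewrite colnorm_sqr inner_adj mulmxA (sqr_sqrtr N0).
apply: le_trans (cauchy_schwarz _ _) _.
by have := mxnorm_op (starmx X *m X) v; rewrite -/N; have := colnorm_ge0 v;
  have := colnorm_ge0 (starmx X *m X *m v); nra.
Qed.

Lemma cnorm_mx_entry X i j : cnorm (X i j) <= cstar_mxnorm X.
Proof.
pose e : 'cV[A]_n := delta_mx j ord0.
have e1 : colnorm e <= 1.
  rewrite -(@ler_pXn2r _ 2) ?nnegrE ?colnorm_ge0 // colnorm_sqr expr1n innerE.
  rewrite (bigD1 j) //= big1 => [|k kj]; last by rewrite !mxE (negbTE kj) /= mulr0.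
  by rewrite !mxE !eqxx /= star1 mulr1 addr0 cnorm1.
have -> : X i j = (X *m e) i ord0 by rewrite -colE mxE.
apply: le_trans (cnorm_entry _ _) _; apply: le_trans (mxnorm_op _ _) _.
by rewrite -[leRHS]mulr1 ler_wpM2l ?mxnorm_ge0.
Qed.

Lemma mxnorm_eq0 X : cstar_mxnorm X = 0 -> X = 0.
Proof.
move=> X0; apply/matrixP => i j; rewrite mxE.
by apply/cnorm_eq0/eqP; rewrite eq_le cnorm_ge0 -{1}X0 cnorm_mx_entry.
Qed.

Lemma mxnorm_complete (u : nat -> 'M[A]_n) :
  (forall e : R, 0 < e -> exists N : nat, forall p q : nat,
       (N <= p)%N -> (N <= q)%N -> cstar_mxnorm (u p - u q) < e) ->
  exists l : 'M[A]_n, forall e : R, 0 < e -> exists N : nat, forall p : nat,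
      (N <= p)%N -> cstar_mxnorm (u p - l) < e.
Proof.
move=> cau.
have lim_ij i j : exists l : A, forall e : R, 0 < e -> exists N : nat,
    forall p : nat, (N <= p)%N -> cnorm (u p i j - l) < e.
  apply: cnorm_complete => e /cau[N hN]; exists N => p q Np Nq.
  apply: le_lt_trans (hN p q Np Nq).
  by have := cnorm_mx_entry (u p - u q) i j; rewrite !mxE.
have [l hl] := choice (fun ij : 'I_n * 'I_n => lim_ij ij.1 ij.2).
exists (\matrix_(i, j) l (i, j)) => e e0.
pose K : R := (n * n).+1%:R.
have K0 : 0 < K by rewrite ltr0n.
have eK : 0 < e / K by rewrite divr_gt0.
have [N hN] := choice (fun ij => hl ij _ eK).
exists (\max_ij N ij)%N => p Np; apply: le_lt_trans (mxnorm_le_sum _) _.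
apply: (@le_lt_trans _ _ (\sum_(i < n) \sum_(j < n) (e / K))).
  apply: ler_sum => i _; apply: ler_sum => j _; rewrite !mxE.
  apply/ltW/(hN (i, j)); apply: leq_trans Np; exact: (leq_bigmax (i, j)).
rewrite !sumr_const card_ord -mulrnA -[_ *+ _]mulr_natr mulrAC ltr_pdivrMr //.
by rewrite ltr_pM2l // ltr_nat.
Qed.

End MatrixNorm.

(** The canonical scaling of ['M[A]_n.+1] is by [A]; a new name for the same
    ring leaves room for the scaling by [R[i]]. *)
Definition cmatrix (R : realType) (A : cstarAlgType R) (n : nat) : Type :=
  'M[A]_n.+1.

Section MatrixAlgebra.
Context {R : realType} (A : cstarAlgType R) (n : nat).

HB.instance Definition _ := GRing.NzRing.copy (cmatrix A n) 'M[A]_n.+1.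

HB.instance Definition _ := @GRing.Zmodule_isLmodule.Build R[i] (cmatrix A n)
  (@cscale R A n.+1 n.+1) (fun a b X => cscaleA a b X) (@cscale1 R A n.+1 n.+1)
  (@cscaleDr R A n.+1 n.+1) (@cscaleDl R A n.+1 n.+1).

HB.instance Definition _ := @GRing.Lmodule_isLalgebra.Build R[i] (cmatrix A n)
  (fun a X Y => @cscale_mull R A n.+1 n.+1 n.+1 a X Y).

HB.instance Definition _ := @GRing.Lalgebra_isAlgebra.Build R[i] (cmatrix A n)
  (fun a X Y => @cscale_mulr R A n.+1 n.+1 n.+1 a X Y).

HB.instance Definition _ := @isCStar.Build R (cmatrix A n)
  (@starmx R A n.+1 n.+1) (@cstar_mxnorm R A n.+1) (@starmxK R A n.+1 n.+1)
  (@starmxD R A n.+1 n.+1) (@starmx_cscale R A n.+1 n.+1)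
  (@starmx_mul R A n.+1 n.+1 n.+1)
  (@mxnorm_eq0 R A n.+1) (@mxnormD R A n.+1) (@mxnormZ R A n.+1)
  (@mxnormM R A n.+1) (@mxnorm_star R A n.+1) (@mxnorm_complete R A n.+1).

End MatrixAlgebra.

(** * Positivity of matrices *)

Section MatrixPositivity.
Context {R : realType} {A : cstarAlgType R}.

Lemma posmx_psd n (X : 'M[A]_n.+1) : posmx X <-> psd (X : cmatrix A n).
Proof. exact: (@cstar_posE R (cmatrix A n) X). Qed.

Lemma posmx0 (X : 'M[A]_0) : posmx X.
Proof. by exists 0; apply/matrixP => -[]. Qed.

Lemma starmx_mulE n (X : 'M[A]_n) i j :
  (starmx X *m X) i j = \sum_k star (X k i) * X k j.
Proof. by rewrite mxE; apply: eq_bigr => k _; rewrite starmxE. Qed.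

Lemma inner_col n (H M : 'M[A]_n) j :
  inner (col j M) (H *m col j M) = (starmx M *m H *m M) j j.
Proof.
have -> : H *m col j M = col j (H *m M) by rewrite !colE mulmxA.
by rewrite innerE -mulmxA [RHS]mxE; apply: eq_bigr => k _; rewrite !mxE.
Qed.

(** Test the quadratic form on the columns of [m], twice the negative part of
    [H]: the diagonal of the positive matrix [- m H m] vanishes, hence so does
    the matrix. *)
Lemma posmx_inner n (H : 'M[A]_n) : starmx H = H ->
  (forall v : 'cV[A]_n, psd (inner v (H *m v))) -> posmx H.
Proof.
case: n H => [|n] H sH pH; first exact: posmx0.
apply/posmx_psd; set h : cmatrix A n := H.
have sh : selfadj h by exact: sH.
have [a [pa sm hm am _]] := abs_exists sh; set m := a - h in sm hm am.
have [r [sr _ rr _]] := psd_sqrt pa.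
pose W : cmatrix A n := r * m.
have WW : star W * W = a * (m * m).
  by rewrite /W starM sm sr -mulrA (mulrA r r) rr mulrA -am -mulrA.
have mhm : m * h * m = - (a * (m * m)) by rewrite -mulrA hm mulrN !mulrA am.
suff W0 : W = 0.
  by rewrite (neg_part_eq0 pa sm hm am) // -WW W0 mulr0.
have diagW j : (a * (m * m) : cmatrix A n) j j = 0.
  apply: psd_anti.
    rewrite -WW (starmx_mulE (W : 'M_n.+1)).
    by apply: psd_sum => k _; exact: psd_starM.
  have := pH (col j (m : 'M_n.+1)); rewrite inner_col.
  have -> : starmx (m : 'M_n.+1) *m H *m (m : 'M_n.+1) = - (a * (m * m)).
    by rewrite (sm : starmx (m : 'M_n.+1) = m); exact: mhm.
  by rewrite mxE.
have Wij i j : (W : 'M_n.+1) i j = 0.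
  apply: starM_eq0; have := diagW j; rewrite -WW (starmx_mulE (W : 'M_n.+1)).
  by move/(psd_sum_eq0 (fun k => psd_starM _)).
by apply/matrixP => i j; rewrite Wij mxE.
Qed.

End MatrixPositivity.

Section MatrixMaps.
Context {R : realType} {A B : cstarAlgType R}.

Lemma map_unital_linear (phi : A -> B) n : unital_linear phi ->
  unital_linear (map_mx phi : cmatrix A n -> cmatrix B n).
Proof.
move=> hl; split=> [a X Y|].
  by apply/matrixP => i j; rewrite !mxE (ulinD hl) (ulinZ hl).
apply/matrixP => i j; rewrite !mxE.
by case: (i == j); rewrite ?(ulin1 hl) ?(ulin0 hl).
Qed.

Lemma map_star_hom (j : A -> B) n : star_hom j ->
  star_hom (map_mx j : cmatrix A n -> cmatrix B n).
Proof.
move=> [jl jM js]; split; first exact: map_unital_linear.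
- move=> X Y; apply/matrixP => i k; rewrite !mxE.
  rewrite (big_morph j (ulinD jl) (ulin0 jl)).
  by apply: eq_bigr => l _; rewrite !mxE jM.
- by move=> X; apply/matrixP => i k; rewrite !mxE js.
Qed.

Section Injective.
Variable j : A -> B.
Hypothesis hj : star_hom j.
Hypothesis j_inj : forall x, j x = 0 -> x = 0.

Lemma map_injective n (X : cmatrix A n) :
  (map_mx j X : cmatrix B n) = 0 -> X = 0.
Proof.
move=> /matrixP X0; apply/matrixP => i k.
by have := X0 i k; rewrite !mxE => /j_inj.
Qed.

Lemma star_hom_mxnorm n (X : 'M[A]_n) :
  cstar_mxnorm (map_mx j X) = cstar_mxnorm X.
Proof.
case: n X => [|n] X; last first.
  exact: (@star_hom_cnorm _ (cmatrix A n) (cmatrix B n) (map_mx j) X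
           (map_star_hom n hj) (@map_injective n)).
have E (C : cstarAlgType R) (Y : 'M[C]_0) : cstar_mxnorm Y = 0.
  apply/eqP; rewrite eq_le mxnorm_ge0 andbT.
  by apply: le_trans (mxnorm_le_sum Y) _; rewrite big_ord0.
by rewrite !E.
Qed.

Lemma star_hom_posmx n (X : 'M[A]_n) : posmx (map_mx j X) <-> posmx X.
Proof.
case: n X => [|n] X; first by split=> _; exact: posmx0.
have hJ := map_star_hom n hj; have [Jl _ Js] := hJ.
split=> /posmx_psd pX; apply/posmx_psd; last exact: (star_hom_psd hJ).
apply: (star_hom_reflect hJ (@map_injective n)) => //.
apply/subr0_eq/map_injective.
rewrite (ulinB Jl) Js; apply/eqP; rewrite subr_eq0; apply/eqP.
exact: psd_selfadj pX.
Qed.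

End Injective.

Lemma complete_isometry_posmx (T : set B) (phi : A -> B) :
  unital_complete_isometry setT T phi ->
  forall n (X : 'M[A]_n), posmx X <-> posmx (map_mx phi X).
Proof.
move=> [[_ hl h1] iso] [|n] X; first by split=> _; exact: posmx0.
have pl : unital_linear phi by split=> // a x y; exact: hl.
have := @unital_isometry_psd R (cmatrix A n) (cmatrix B n) (map_mx phi)
  (map_unital_linear n pl) (fun Y => iso _ Y (fun _ _ => I)) X.
by move=> h; split=> /posmx_psd/h/posmx_psd.
Qed.

End MatrixMaps.

(** * States from maximal cones *)

Lemma zorn_above (T : Type) (P : set (set T)) (K0 : set T) : P K0 ->
  (forall F : set (set T), F !=set0 -> F `<=` P -> total_on F subset ->
     P (\bigcup_(X in F) X)) ->
  exists K, [/\ K0 `<=` K, P K & forall B, K `<=` B -> P B -> B `<=` K].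
Proof.
move=> PK0 chainP; pose Q : set (set T) := [set X | P (K0 `|` X)].
have [|X [QX maxX]] := @Zorn_bigcup T Q.
  move=> F FQ totF; rewrite /Q /=.
  have [[Y FY]|F0] := pselect (F !=set0); last first.
    have -> : \bigcup_(X in F) X = set0.
      by apply/seteqP; split=> // t [Y FY _]; case: F0; exists Y.
    by rewrite setU0.
  have -> : K0 `|` \bigcup_(X in F) X =
      \bigcup_(Z in [set K0 `|` X | X in F]) Z.
    apply/seteqP; split=> t.
      case=> [K0t|[X FX Xt]].
        by exists (K0 `|` Y); [exists Y | left].
      by exists (K0 `|` X); [exists X | right].
    by case=> _ [X FX <-] [K0t|Xt]; [left | right; exists X].
  apply: chainP.
  - by exists (K0 `|` Y), Y.
  - by move=> _ [X FX <-]; exact: FQ.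
  - move=> _ _ [X FX <-] [Z FZ <-].
    by case: (totF _ _ FX FZ) => XZ; [left | right]; exact: setUS.
exists (K0 `|` X); split=> //.
move=> B KB PB.
have XB : X `<=` B by move=> t Xt; apply: KB; right.
have QB : Q B.
  by rewrite /Q /=; have /setUidPr -> : K0 `<=` B by move=> t ?; apply: KB; left.
have [BX|nBX] := pselect (B `<=` X); first by move=> t /BX; right.
by case: (maxX B) => //; split.
Qed.

Section States.
Context {R : realType} {A : cstarAlgType R}.
Implicit Types (K : set A) (f g : A -> R[i]) (a b x y : A) (r s t e : R).

Definition state f : Prop :=
  [/\ forall (c : R[i]) x y, f (c *: x + y) = c * f x + f y, f 1 = 1 &
      forall x, psd x -> 0 <= f x].

Section StateTheory.
Variable f : A -> R[i].
Hypothesis hf : state f.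

Lemma state1 : f 1 = 1. Proof. by case: hf. Qed.
Lemma stateD x y : f (x + y) = f x + f y.
Proof. by case: hf => h _ _; rewrite -[x]scale1r h scale1r mul1r. Qed.
Lemma state0 : f 0 = 0.
Proof. by apply: (addrI (f 0)); rewrite -stateD !addr0. Qed.
Lemma stateZ c x : f (c *: x) = c * f x.
Proof. by case: hf => h _ _; rewrite -[c *: x]addr0 h state0 addr0. Qed.
Lemma stateN x : f (- x) = - f x.
Proof. by rewrite -scaleN1r stateZ mulN1r. Qed.
Lemma stateB x y : f (x - y) = f x - f y.
Proof. by rewrite stateD stateN. Qed.
Lemma state_scalar c : f (c *: 1) = c.
Proof. by rewrite stateZ state1 mulr1. Qed.
Lemma state_ge0 x : psd x -> 0 <= f x. Proof. by case: hf => _ _; apply. Qed.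
Lemma state_sum (I : Type) (s : seq I) (P : pred I) (F : I -> A) :
  f (\sum_(i <- s | P i) F i) = \sum_(i <- s | P i) f (F i).
Proof. exact: (big_morph f stateD state0). Qed.

Lemma state_real x : selfadj x -> f x = (Re (f x))%:C%C.
Proof.
move=> /selfadj_psdB[c [_ /state_ge0]]; rewrite stateB state_scalar.
by case: (f x) => p q /=; simpc => /andP[/eqP q0 _]; rewrite -[q]opprK q0 oppr0.
Qed.

Lemma state_Re_ge0 x : psd x -> 0 <= Re (f x).
Proof.
by move=> px; have := state_ge0 px; rewrite (state_real (psd_selfadj px)) ler0c.
Qed.

Lemma state_ri x : f x = (Re (f (rpart x)) +i* Re (f (ipart x)))%C.
Proof.
rewrite {1}(ri_partE x) stateD (stateZ 'i%C).
rewrite (state_real (selfadj_rpart x)) (state_real (selfadj_ipart x)) /=.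
by simpc.
Qed.

Lemma state_star x : f (star x) = conjc (f x).
Proof.
rewrite [in RHS]state_ri state_ri /rpart /ipart starK [star x + x]addrC.
by rewrite -[star x - x]opprB scalerN stateN; case: (f (_ *: (x - star x))).
Qed.

Lemma state_Re_le x c : selfadj x -> cnorm x <= c -> `|Re (f x)| <= c.
Proof.
move=> sx xc; rewrite ler_norml.
have := state_Re_ge0 (psd_le_norm sx xc); have := state_Re_ge0 (psd_ge_norm sx xc).
rewrite stateD stateB state_scalar; case: (f x) => p q /=; lra.
Qed.

End StateTheory.

Lemma rpartD x y : rpart (x + y) = rpart x + rpart y.
Proof. by rewrite /rpart starD addrACA scalerDr. Qed.

Lemma ipartD x y : ipart (x + y) = ipart x + ipart y.
Proof. by rewrite /ipart starD opprD addrACA scalerDr. Qed.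

Lemma rpart_ipartZ (c : R[i]) x :
  rpart (c *: x) = Re c *r rpart x - Im c *r ipart x /\
  ipart (c *: x) = Re c *r ipart x + Im c *r rpart x.
Proof.
set u := _ - _; set v := Re c *r ipart x + _.
have sa := selfadj_rpart x; have sb := selfadj_ipart x.
have su : selfadj u by apply: selfadjB; exact: selfadjR.
have sv : selfadj v by apply: selfadjD; exact: selfadjR.
suff -> : c *: x = u + 'i%C *: v by rewrite rpart_ri // ipart_ri.
rewrite {1}(ri_partE x) /u /v; set a := rpart x; set b := ipart x.
rewrite scalerDr scalerA.
have -> : c * 'i%C = - (Im c)%:C%C + 'i%C * (Re c)%:C%C.
  by case: c {u v su sv} => p q /=; simpc.
rewrite {1}(complexE c) !scalerDl scaleNr -!scalerA scalerDr addrACA.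
by congr (_ + _); rewrite addrC.
Qed.

Definition proper_cone K : Prop :=
  [/\ forall x, K x -> selfadj x, forall x, psd x -> K x,
      forall x y, K x -> K y -> K (x + y),
      forall r x, 0 <= r -> K x -> K (r *r x) & ~ K (- 1)].

Definition total K : Prop := forall x, selfadj x -> K x \/ K (- x).

(** [s] is the cut that the order with positive cone [K] makes at [x]. *)
Definition cut K x s : Prop :=
  forall e, 0 < e -> K (x - (s - e) *r 1) /\ K ((s + e) *r 1 - x).

Section Cone.
Variable K : set A.
Hypothesis hK : proper_cone K.

Lemma coneD x y : K x -> K y -> K (x + y). Proof. by case: hK => _ _ + _ _; apply. Qed.
Lemma coneR r x : 0 <= r -> K x -> K (r *r x). Proof. by case: hK => _ _ _ + _; apply. Qed.
Lemma cone_psd x : psd x -> K x. Proof. by case: hK => _ + _ _ _; apply. Qed.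

(** Otherwise [- 1] would be a positive multiple of [r] and lie in [K]. *)
Lemma cone_scalar r : K (r *r 1) -> 0 <= r.
Proof.
case: hK => _ _ _ _ KN1 Kr; rewrite leNgt; apply/negP => r0; apply: KN1.
have -> : - 1 = (- r^-1) *r (r *r 1) :> A.
  by rewrite rscaleA mulNr mulVf ?lt_eqF // rscaleNl rscale1.
by apply: coneR => //; rewrite oppr_ge0 invr_le0 ltW.
Qed.

Lemma cut_le x y s t : K (y - x) -> cut K x s -> cut K y t -> s <= t.
Proof.
move=> Kyx hs ht; rewrite leNgt; apply/negP => ts.
have e0 : 0 < (s - t) / 4 by lra.
have [h _] := hs _ e0; have [_ h'] := ht _ e0.
have := coneD (coneD h h') Kyx.
have -> : x - (s - (s - t) / 4) *r 1 + ((t + (s - t) / 4) *r 1 - y) + (y - x) =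
    (- ((s - t) / 2)) *r 1.
  rewrite [x - _]addrC -!addrA addrCA [x + _]addrC -!addrA addKr addNr addr0.
  rewrite -rscaleNl -rscaleDl; congr (_%:C%C *: _); by field.
by move/cone_scalar; lra.
Qed.

Lemma cut_uniq x s t : cut K x s -> cut K x t -> s = t.
Proof.
have K0 : K (x - x) by rewrite subrr; exact/cone_psd/psd0.
by move=> hs ht; apply/eqP; rewrite eq_le (cut_le K0 hs ht) (cut_le K0 ht hs).
Qed.

Lemma cut_scalar r : cut K (r *r 1) r.
Proof.
move=> e e0; rewrite -!rscaleBl subKr addrAC subrr add0r.
by split; apply/cone_psd/psd_scalar/ltW.
Qed.

Lemma cut_ge0 x s : K x -> cut K x s -> 0 <= s.
Proof.
move=> Kx hs; apply: (@cut_le 0 x) => //; first by rewrite subr0.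
by rewrite -(rscale0 (1 : A)); exact: cut_scalar.
Qed.

Lemma cut_gt0 x s : cut K x s -> 0 < s -> K x.
Proof. by move=> hs /hs[]; rewrite subrr rscale0 subr0. Qed.

Lemma cutD x y s t : cut K x s -> cut K y t -> cut K (x + y) (s + t).
Proof.
move=> hs ht e e0; have e2 : 0 < e / 2 by lra.
have [h1 h2] := hs _ e2; have [h3 h4] := ht _ e2.
have -> : s + t - e = (s - e / 2) + (t - e / 2) by lra.
have -> : s + t + e = (s + e / 2) + (t + e / 2) by lra.
rewrite (rscaleDl (s - _)) (rscaleDl (s + _)) !opprD addrACA [X in _ /\ K X]addrACA.
by split; exact: coneD.
Qed.

Lemma cutN x s : cut K x s -> cut K (- x) (- s).
Proof.
move=> hs e /hs[h1 h2]; split.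
  have -> : - s - e = - (s + e) by lra.
  by rewrite rscaleNl opprK addrC.
have -> : - s + e = - (s - e) by lra.
by rewrite rscaleNl opprK addrC.
Qed.

Lemma cutR r x s : cut K x s -> cut K (r *r x) (r * s).
Proof.
wlog r0 : r x s / 0 < r.
  move=> hpos hs; case: (ltrgt0P r) => [r0|r0|->]; first exact: hpos.
    rewrite -[r]opprK rscaleNl mulNr; apply/cutN/hpos => //.
    by rewrite oppr_gt0.
  by rewrite rscale0 mul0r -(rscale0 (1 : A)); exact: cut_scalar.
move=> hs e e0; have er : 0 < e / r by rewrite divr_gt0.
have [h1 h2] := hs _ er.
have -> : r * s - e = r * (s - e / r) by field; rewrite gt_eqF.
have -> : r * s + e = r * (s + e / r) by field; rewrite gt_eqF.
by rewrite -!rscaleA -!scalerBr; split; apply: coneR => //; exact: ltW.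
Qed.

Lemma cut_exists x : total K -> selfadj x -> exists s, cut K x s.
Proof.
move=> totK sx; pose E : set R := [set r | K (x - r *r 1)].
have ubE : ubound E (cnorm x).
  move=> r Er; rewrite -subr_ge0; apply: cone_scalar.
  rewrite rscaleBl -(subrKA x); apply: coneD => //.
  exact/cone_psd/psd_le_norm/lexx.
have supE : has_sup E.
  split; last by exists (cnorm x).
  exists (- cnorm x); rewrite /E /= rscaleNl opprK addrC.
  exact/cone_psd/psd_ge_norm/lexx.
exists (sup E) => e e0; split.
  have [r Er hr] := sup_adherent e0 supE.
  have -> : x - (sup E - e) *r 1 = (x - r *r 1) + (r - (sup E - e)) *r 1.
    by rewrite [in RHS]rscaleBl addrA subrK.
  by apply: coneD => //; apply/cone_psd/psd_scalar; rewrite subr_ge0 ltW.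
have sE : selfadj (x - (sup E + e) *r 1) by apply/selfadjB/selfadj_scalar.
case: (totK _ sE) => [h|]; last by rewrite opprB.
have := sup_upper_bound supE h; lra.
Qed.

(** Every self-adjoint element makes a cut in the reals for the total order
    with cone [K], and cuts are additive and homogeneous. *)
Lemma cone_state : total K ->
  exists2 f, state f & forall x, selfadj x -> cut K x (Re (f x)).
Proof.
move=> totK.
have [g hg] : {g : A -> R & forall x, selfadj x -> cut K x (g x)}.
  apply: (@choice _ _ (fun x s => selfadj x -> cut K x s)) => x.
  have [sx|nsx] := pselect (selfadj x); last by exists 0.
  by have [s hs] := cut_exists totK sx; exists s.
have gE x s : selfadj x -> cut K x s -> g x = s.
  by move=> sx; apply: cut_uniq; exact: hg.
have g0 : g 0 = 0.
  by apply: gE; [exact: selfadj0 | rewrite -(rscale0 (1 : A)); exact: cut_scalar].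
pose f x : R[i] := (g (rpart x) +i* g (ipart x))%C.
have fE x : selfadj x -> f x = (g x)%:C%C.
  by move=> sx; rewrite /f rpart_sa // ipart_sa // g0.
exists f; last by move=> x sx; rewrite fE //; exact: hg.
split.
- move=> c x y; rewrite /f rpartD ipartD.
  have [-> ->] := rpart_ipartZ c x.
  set a := rpart x; set b := ipart x.
  have [sa sb] : selfadj a /\ selfadj b.
    by split; [exact: selfadj_rpart | exact: selfadj_ipart].
  have [su sv] : selfadj (rpart y) /\ selfadj (ipart y).
    by split; [exact: selfadj_rpart | exact: selfadj_ipart].
  rewrite (gE (Re c *r a - Im c *r b + rpart y) (Re c * g a - Im c * g b + g (rpart y))); last first.
  - apply: cutD; last exact: hg.
    by apply: cutD; [exact/cutR/hg | exact/cutN/cutR/hg].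
  - by apply: selfadjD => //; apply: selfadjB; exact: selfadjR.
  rewrite (gE (Re c *r b + Im c *r a + ipart y) (Re c * g b + Im c * g a + g (ipart y))); last first.
  - apply: cutD; last exact: hg.
    by apply: cutD; exact/cutR/hg.
  - by apply: selfadjD => //; apply: selfadjD; exact: selfadjR.
  by case: (c) => p q /=; simpc.
- rewrite fE ?(gE 1 1) //; [exact: selfadj1 | | exact: selfadj1].
  by rewrite -[X in cut _ X]rscale1; exact: cut_scalar.
- move=> x px; rewrite (fE _ (psd_selfadj px)) ler0c.
  by apply: (@cut_ge0 x); [exact: cone_psd | exact/hg/psd_selfadj].
Qed.

End Cone.
End States.

Section MaximalCones.
Context {R : realType} {A : cstarAlgType R}.
Implicit Types (K : set A) (a b x y : A) (r s t e : R).

Lemma proper_cone_chain (F : set (set A)) : F !=set0 -> F `<=` proper_cone ->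
  total_on F subset -> proper_cone (\bigcup_(X in F) X).
Proof.
move=> [Y FY] Fp totF; split.
- by move=> x [X /Fp[h _ _ _ _] /h].
- by move=> x px; exists Y => //; have [_ h _ _ _] := Fp _ FY; exact: h.
- move=> x y [X FX Xx] [Z FZ Zy]; case: (totF _ _ FX FZ) => XZ.
    by exists Z => //; have [_ _ h _ _] := Fp _ FZ; apply: h => //; exact: XZ.
  by exists X => //; have [_ _ h _ _] := Fp _ FX; apply: h => //; exact: XZ.
- by move=> r x r0 [X FX Xx]; exists X => //; have [_ _ _ h _] := Fp _ FX; exact: h.
- by move=> [X /Fp[_ _ _ _]].
Qed.

(** If neither [x] nor [- x] can be adjoined to [K], then [- 1 = k + t x] and
    [- 1 = l - u x] with [k], [l] in [K] and [t], [u >= 0]; eliminating [x] puts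
    [- (t + u)] in [K]. *)
Lemma maximal_proper_cone_total K : proper_cone K ->
  (forall L, K `<=` L -> proper_cone L -> L `<=` K) -> total K.
Proof.
move=> hK maxK x sx; have [Ksa Kpsd KD KR KN1] := hK.
have K0 : K 0 by exact/Kpsd/psd0.
have ext a : selfadj a -> K a \/ exists k t, [/\ K k, 0 <= t & - 1 = k + t *r a].
  move=> sa; pose L : set A := [set k + t *r a | k in K & t in [set t | 0 <= t]].
  have [[k Kk [t t0 h]]|LN1] := pselect (L (- 1)); first by right; exists k, t.
  left; apply: (maxK L); last by exists 0 => //; exists 1 => //=; rewrite rscale1 add0r.
    by move=> k Kk; exists k => //; exists 0 => //=; rewrite rscale0 addr0.
  split=> //.
  - by move=> _ [k Kk [t t0 <-]]; apply: selfadjD; [exact: Ksa | exact: selfadjR].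
  - by move=> y /Kpsd Ky; exists y => //; exists 0 => //=; rewrite rscale0 addr0.
  - move=> _ _ [k Kk [t t0 <-]] [l Kl [u u0 <-]]; exists (k + l); first exact: KD.
    by exists (t + u); [exact: addr_ge0 | rewrite rscaleDl addrACA].
  - move=> r _ r0 [k Kk [t t0 <-]]; exists (r *r k); first exact: KR.
    by exists (r * t); [exact: mulr_ge0 | rewrite scalerDr rscaleA].
case: (ext x sx) => [|[k [t [Kk t0 hk]]]]; first by left.
case: (ext (- x) (selfadjN sx)) => [|[l [u [Kl u0 hl]]]]; first by right.
exfalso; have [t00|tN0] := eqVneq t 0.
  by apply: KN1; rewrite hk t00 rscale0 addr0.
have tu : 0 < t + u by rewrite ltr_wpDr // lt_def tN0.
have : K ((- (t + u)) *r 1).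
  have -> : (- (t + u)) *r 1 = u *r k + t *r l :> A.
    rewrite (canRL (addrK _) (esym hk)) (canRL (addrK _) (esym hl)) scalerN opprK.
    rewrite scalerBr scalerDr !rscaleA [t * u]mulrC !scalerN addrACA addNr addr0.
    by rewrite -opprD -rscaleDl rscaleNl addrC.
  by apply: KD; exact: KR.
by move/(cone_scalar hK); lra.
Qed.

Lemma proper_cone_state K : proper_cone K ->
  exists2 f, state f & forall x, K x -> 0 <= Re (f x).
Proof.
move=> hK.
have [M [KM hM maxM]] := zorn_above hK (@proper_cone_chain).
have [f hf cutf] := cone_state hM (maximal_proper_cone_total hM maxM).
exists f => // x /KM Mx; apply: (cut_ge0 hM Mx).
by apply: cutf; case: hM => h _ _ _ _; exact: h.
Qed.

(** The Hahn-Banach theorem for states.  The cone generated by the positive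
    elements, by the elements of [E] on which [f] is nonnegative and by [s - x]
    is proper: if [- 1 = p + y + t (s - x)] with [t > 0], then [s + (1 + y) / t]
    is a minorant of [x] in [E] on which [f] exceeds [s].  A state that is
    nonnegative on the cone extends [f], since the cone contains both
    [y - f y] and [f y - y] for self-adjoint [y] in [E]. *)
Lemma state_extension (E : set A) (f : A -> R[i]) (x : A) (s : R) :
  operator_system E ->
  (forall (c : R[i]) y z, E y -> E z -> f (c *: y + z) = c * f y + f z) ->
  f 1 = 1 ->
  (forall y, E y -> psd y -> 0 <= f y) ->
  selfadj x ->
  (forall y, E y -> selfadj y -> psd (x - y) -> Re (f y) <= s) ->
  exists g, [/\ state g, forall y, E y -> g y = f y & Re (g x) <= s].
Proof.
move=> [E1 El Es] fl f1 fp sx hs.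
have E0 : E 0.
  by have := El (- 1) 1 1 E1 E1; rewrite scaleN1r addNr.
have ED y z : E y -> E z -> E (y + z).
  by move=> Ey Ez; have := El 1 y z Ey Ez; rewrite scale1r.
have EZ c y : E y -> E (c *: y).
  by move=> Ey; have := El c y 0 Ey E0; rewrite addr0.
have EN y : E y -> E (- y) by move=> /(EZ (- 1)); rewrite scaleN1r.
have fD y z : E y -> E z -> f (y + z) = f y + f z.
  by move=> Ey Ez; have := fl 1 y z Ey Ez; rewrite scale1r mul1r.
have f0 : f 0 = 0 by apply: (addrI (f 0)); rewrite -fD // !addr0.
have fZ c y : E y -> f (c *: y) = c * f y.
  by move=> Ey; have := fl c y 0 Ey E0; rewrite !addr0 f0 addr0.
have fN y : E y -> f (- y) = - f y.
  by move=> Ey; rewrite -scaleN1r fZ // mulN1r.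
have ReR (r : R) (c : R[i]) : Re (r%:C%C * c) = r * Re c.
  by case: c => p q /=; rewrite mul0r subr0.
have ReD (c d : R[i]) : Re (c + d) = Re c + Re d by case: c; case: d.
have ReN (c : R[i]) : Re (- c) = - Re c by case: c.
have fRe y : E y -> psd y -> 0 <= Re (f y).
  move=> Ey py; have := fp y Ey py.
  by case: (f y) => p q /=; simpc => /andP[].
pose K : set A := [set k | exists p y t, [/\ psd p, E y /\ selfadj y,
  0 <= Re (f y), 0 <= t & k = p + y + t *r (s *r 1 - x)]].
have sxs : selfadj (s *r 1 - x) by apply: selfadjB => //; exact: selfadj_scalar.
have hK : proper_cone K.
  split.
  - move=> _ [p [y [t [pp [Ey sy] _ _ ->]]]]; apply: selfadjD; last exact: selfadjR.
    by apply: selfadjD => //; exact: psd_selfadj.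
  - move=> p pp; exists p, 0, 0; rewrite f0 rscale0 !addr0; split => //.
    by split=> //; exact: selfadj0.
  - move=> _ _ [p [y [t [pp [Ey sy] fy t0 ->]]]] [q [z [u [pq [Ez sz] fz u0 ->]]]].
    exists (p + q), (y + z), (t + u); split.
    + exact: psdD.
    + by split; [exact: ED | exact: selfadjD].
    + by rewrite fD // ReD addr_ge0.
    + exact: addr_ge0.
    + by rewrite rscaleDl addrACA [p + y + _]addrACA.
  - move=> r _ r0 [p [y [t [pp [Ey sy] fy t0 ->]]]].
    exists (r *r p), (r *r y), (r * t); split.
    + exact: psdR.
    + by split; [exact: EZ | exact: selfadjR].
    + by rewrite fZ // ReR mulr_ge0.
    + exact: mulr_ge0.
    + by rewrite scalerDr [r *r (p + y)]scalerDr rscaleA.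
  - move=> [p [y [t [pp [Ey sy] fy t0 h]]]].
    have pE : p = - (1 + y) + t *r (x - s *r 1).
      by rewrite -[x - _]opprB scalerN opprD h addrAC addrK addrK.
    have [t00|tN0] := eqVneq t 0.
      have : 0 <= Re (f (- (1 + y))).
        apply: fRe; first by apply/EN/ED.
        by move: pp; rewrite pE t00 rscale0 addr0.
      by rewrite fN ?fD ?f1; [case: (f y) fy => a b /=; lra | | | exact: ED].
    have tp : 0 < t by rewrite lt_def tN0.
    set z := s *r 1 + t^-1 *r (1 + y).
    have Ez : E z by apply: (ED); apply: (EZ) => //; exact: ED.
    have sz : selfadj z.
      apply: selfadjD; first exact: selfadj_scalar.
      by apply/selfadjR/selfadjD => //; exact: selfadj1.
    have : Re (f z) <= s.
      apply: hs => //; have -> : x - z = t^-1 *r p.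
        by rewrite pE [RHS]scalerDr rscaleVK // scalerN /z opprD addrA addrC.
      by apply: psdR => //; rewrite invr_ge0.
    rewrite /z fD; [|exact: EZ|by apply/EZ/ED].
    rewrite !fZ ?fD //; last exact: ED.
    rewrite f1 ReD !ReR ReD /= mulr1.
    have : 0 < t^-1 * (1 + Re (f y)) by rewrite mulr_gt0 ?invr_gt0 // ltr_pwDl.
    lra.
have [g hg gK] := proper_cone_state hK.
have Krl y : E y -> selfadj y -> 0 <= Re (f y) -> K y.
  move=> Ey sy fy; exists 0, y, 0; rewrite rscale0 addr0 add0r; split=> //.
  exact: psd0.
have fIm y : E y -> selfadj y -> f y = (Re (f y))%:C%C.
  move=> Ey sy; have [c [_ pc]] := selfadj_psdB sy.
  have Ec : E (c%:C%C *: 1 - y) by apply: (ED); [exact: EZ | exact: EN].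
  have := fp _ Ec pc.
  rewrite (fD _ _ (EZ _ _ E1) (EN _ Ey)) (fN _ Ey) (fZ _ _ E1) f1 mulr1.
  case: (f y) => p q /=; simpc => /andP[/eqP q0 _].
  by rewrite -[q]opprK q0 oppr0.
have gf_sa y : E y -> selfadj y -> g y = f y.
  move=> Ey sy; rewrite (state_real hg sy) fIm //; congr (_%:C%C).
  have le z : E z -> selfadj z -> Re (f z) <= Re (g z).
    move=> Ez sz; have : K (z - (Re (f z)) *r 1).
      apply: Krl; first by apply/ED/EN/EZ.
        by apply: selfadjB => //; exact: selfadj_scalar.
      rewrite (fD _ _ Ez (EN _ (EZ _ _ E1))) (fN _ (EZ _ _ E1)) (fZ _ _ E1).
      by rewrite f1 mulr1 ReD ReN /= subrr.
    by move/gK; rewrite (stateB hg) (state_scalar hg) ReD ReN /= subr_ge0.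
  apply/eqP; rewrite eq_le le // andbT.
  have := le (- y) (EN _ Ey) (selfadjN sy).
  by rewrite fN // (stateN hg) !ReN lerN2.
exists g; split=> //.
- move=> y Ey; rewrite [in LHS](ri_partE y) [in RHS](ri_partE y).
  have Er : E (rpart y) by apply/EZ/ED => //; exact: Es.
  have Ei : E (ipart y) by apply/EZ/ED => //; apply/EN/Es.
  rewrite (stateD hg) (stateZ hg 'i%C) (fD _ _ Er (EZ _ _ Ei)) (fZ _ _ Ei).
  by rewrite (gf_sa _ Er (selfadj_rpart y)) (gf_sa _ Ei (selfadj_ipart y)).
- have : K (s *r 1 - x).
    exists 0, 0, 1; rewrite f0 rscale1 !add0r; split=> //; first exact: psd0.
    by split=> //; exact: selfadj0.
  by move/gK; rewrite (stateB hg) (state_scalar hg) ReD ReN /=; lra.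
Qed.

End MaximalCones.

(** * Characters of a commutative algebra *)

Section Characters.
Context {R : realType} {D : cstarAlgType R}.
Hypothesis comD : forall a b : D, a * b = b * a.
Implicit Types (K : set D) (a b x y : D) (r s t e : R).

Definition character (f : D -> R[i]) : Prop :=
  state f /\ forall x y, f (x * y) = f x * f y.

Definition preordering K : Prop :=
  proper_cone K /\ forall x y, K x -> K y -> K (x * y).

Lemma selfadj_mul a b : selfadj a -> selfadj b -> selfadj (a * b).
Proof. by move=> sa sb; exact: selfadjM. Qed.

Lemma psd_mul a b : psd a -> psd b -> psd (a * b).
Proof. by move=> pa pb; exact: psdM. Qed.

Lemma mulACA (a b c d : D) : (a * b) * (c * d) = (a * c) * (b * d).
Proof. by rewrite -!mulrA (mulrA b) (comD b) -mulrA. Qed.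

Lemma preordering_chain (F : set (set D)) : F !=set0 -> F `<=` preordering ->
  total_on F subset -> preordering (\bigcup_(X in F) X).
Proof.
move=> F0 Fp totF; split; first by apply: proper_cone_chain => // X /Fp[].
move=> x y [X FX Xx] [Z FZ Zy]; case: (totF _ _ FX FZ) => XZ.
  by exists Z => //; have [_ h] := Fp _ FZ; apply: h => //; exact: XZ.
by exists X => //; have [_ h] := Fp _ FX; apply: h => //; exact: XZ.
Qed.

(** The smallest preordering containing [K] and [a]. *)
Definition adjoin K a : set D := [set k + q * a | k in K & q in K].

Lemma preordering_adjoin K a : preordering K -> selfadj a ->
  ~ adjoin K a (- 1) -> preordering (adjoin K a).
Proof.
move=> [[Ksa Kpsd KD KR KN1] KM] sa LN1.
have K0 : K 0 by exact/Kpsd/psd0.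
split; first split=> //.
- move=> _ [k Kk [q Kq <-]]; apply: selfadjD; first exact: Ksa.
  by apply: selfadj_mul => //; exact: Ksa.
- by move=> y /Kpsd Ky; exists y => //; exists 0 => //; rewrite mul0r addr0.
- move=> _ _ [k Kk [q Kq <-]] [l Kl [p Kp <-]]; exists (k + l); first exact: KD.
  by exists (q + p); [exact: KD | rewrite mulrDl addrACA].
- move=> r _ r0 [k Kk [q Kq <-]]; exists (r *r k); first exact: KR.
  by exists (r *r q); [exact: KR | rewrite scalerDr scalerAl].
- move=> _ _ [k Kk [q Kq <-]] [l Kl [p Kp <-]].
  exists (k * l + q * p * (a * a)).
    by apply: (KD); [exact: KM | apply: (KM); [exact: KM | exact/Kpsd/psd_sqr]].
  exists (k * p + q * l); first by apply: (KD); exact: KM.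
  have e1 : q * a * (p * a) = q * p * (a * a) by rewrite mulACA.
  have e2 : q * a * l = q * l * a by rewrite -mulrA (comD a) mulrA.
  rewrite [RHS]mulrDl mulrDr mulrDl mulrDr e1 e2 (mulrA k).
  by rewrite [q * l * a + _]addrC addrACA.
Qed.

(** As for cones, but now [- 1 = k + q a] and [- 1 = l - p a] with coefficients
    in [K], and [a] is eliminated by multiplying [q a] with [p a]. *)
Lemma maximal_preordering_total K : preordering K ->
  (forall L, K `<=` L -> preordering L -> L `<=` K) -> total K.
Proof.
move=> hK maxK a sa; have [[Ksa Kpsd KD KR KN1] KM] := hK.
have ext b : selfadj b -> K b \/ adjoin K b (- 1).
  move=> sb; have [h|LN1] := pselect (adjoin K b (- 1)); first by right.
  left; apply: (maxK _ _ (preordering_adjoin hK sb LN1)).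
    by move=> k Kk; exists k => //; exists 0; rewrite ?mul0r ?addr0 //; exact/Kpsd/psd0.
  exists 0; first exact/Kpsd/psd0.
  by exists 1; [exact/Kpsd/psd1 | rewrite mul1r add0r].
case: (ext a sa) => [|[k Kk [q Kq hq]]]; first by left.
case: (ext (- a) (selfadjN sa)) => [|[l Kl [p Kp hp]]]; first by right.
exfalso; apply: KN1.
have qa : q * a = - (1 + k) by rewrite opprD -hq addrAC subrr add0r.
have pa : p * a = 1 + l by rewrite -[1]opprK -hp mulrN opprD opprK addrAC addNr add0r.
have -> : -1 = k + l + k * l + q * p * (a * a).
  rewrite -mulACA qa pa mulNr mulrDl !mulrDr !mul1r mulr1.
  have -> : 1 + l + (k + k * l) = 1 + (k + l + k * l).
    by rewrite -!addrA; congr (1 + _); rewrite addrCA.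
  by rewrite [- (1 + _)]opprD addrCA subrr addr0.
apply: (KD); first by apply: (KD); [exact: KD | exact: KM].
by apply: (KM); [exact: KM | exact/Kpsd/psd_sqr].
Qed.

(** The state given by a total preordering is multiplicative: if it vanishes at
    a self-adjoint [a], then [e + a] and [e - a] lie in the preordering, and so
    does [e^2 - a^2], for every [e > 0]; hence it vanishes at [a^2]. *)
Lemma preordering_character K : preordering K ->
  exists2 f, character f & forall x, K x -> 0 <= Re (f x).
Proof.
move=> hK; have [M [KM hM maxM]] := zorn_above hK (@preordering_chain).
have [hMc MM] := hM.
have [f hf cutf] := cone_state hMc (maximal_preordering_total hM maxM).
have f_ge0 x : M x -> 0 <= Re (f x).
  by move=> Mx; apply: (cut_ge0 hMc Mx); apply: cutf; case: hMc => h _ _ _ _; exact: h.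
have sqr0 a : selfadj a -> f a = 0 -> f (a * a) = 0.
  move=> sa fa; have pos e : 0 < e -> M (e *r 1 + a) /\ M (e *r 1 - a).
    move=> e0; split; apply: (cut_gt0 (s := e)) => //.
      have := cutf (e *r 1 + a); rewrite (stateD hf) fa addr0 (state_scalar hf); apply.
      by apply: selfadjD => //; exact: selfadj_scalar.
    have := cutf (e *r 1 - a); rewrite (stateB hf) fa subr0 (state_scalar hf); apply.
    by apply: selfadjB => //; exact: selfadj_scalar.
  rewrite (state_real hf (selfadj_sqr sa)); congr (_%:C%C).
  apply/eqP; rewrite eq_le (state_Re_ge0 hf (psd_sqr sa)) andbT leNgt.
  apply/negP => p; set e := Num.min 1 (Re (f (a * a)) / 2).
  have e0 : 0 < e by rewrite lt_min ltr01 divr_gt0.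
  have [h1 h2] := pos e e0; have := f_ge0 _ (MM _ _ h1 h2).
  have -> : (e *r 1 + a) * (e *r 1 - a) = (e * e) *r 1 - a * a.
    rewrite mulrDl !mulrBr !scalar_mull scalar_mulr rscaleA addrA.
    by rewrite subrK.
  rewrite (stateB hf) (state_scalar hf).
  have e1 : e <= 1 by rewrite ge_min lexx.
  have e2 : e <= Re (f (a * a)) / 2 by rewrite ge_min lexx orbT.
  by case: (f (a * a)) p e2 => u v /=; nra.
have sqr a : selfadj a -> f (a * a) = f a * f a.
  move=> sa; have fa := state_real hf sa; set r := Re (f a) in fa.
  have := sqr0 (a - r *r 1); rewrite (stateB hf) (state_scalar hf) fa subrr.
  move=> /(_ (selfadjB sa (selfadj_scalar _)) erefl).
  rewrite mulrBl !mulrBr !scalar_mull scalar_mulr rscaleA !(stateB hf) !(stateZ hf).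
  rewrite (state1 hf) fa rmorphM mulr1 subrr subr0.
  by move/eqP; rewrite subr_eq0 => /eqP.
have mul_sa a b : selfadj a -> selfadj b -> f (a * b) = f a * f b.
  move=> sa sb; have := sqr (a + b) (selfadjD sa sb).
  rewrite !mulrDl !mulrDr !(stateD hf) !sqr // (comD b a) mulrDl !mulrDr.
  rewrite (mulrC (f b) (f a)) -!addrA => /addrI; rewrite !addrA => /addIr.
  by rewrite -!mulr2n => /eqP; rewrite eqrMn2r //= => /eqP.
exists f => // [|x /KM]; last exact: f_ge0.
split=> // x y; rewrite (ri_partE x) (ri_partE y).
move: (selfadj_rpart x) (selfadj_ipart x) (selfadj_rpart y) (selfadj_ipart y).
move: (rpart x) (ipart x) (rpart y) (ipart y) => a b c d sa sb sc sd.
rewrite mulrDl !mulrDr -!scalerAl -!scalerAr.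
rewrite !(stateD hf) !(stateZ hf 'i%C) !mul_sa //.
by ring.
Qed.

(** If [d^* d] has norm [2 e > 0] then [a = e - d^* d] is not positive.  The
    elements [p - q a] with positive [p] and [q] form a preordering: if
    [- 1 = p - q a], then [m^2 (1 + p) = m^2 q a = - q n m^2] for the
    absolute value [n] of [a] and [m = n - a], so that [m = 0].  A character
    which is nonnegative on this preordering takes a value at least [e] at
    [d^* d]. *)
Lemma character_separates d : (forall f, character f -> f d = 0) -> d = 0.
Proof.
move=> fd0; apply: starM_eq0; apply/cnorm_eq0/eqP; rewrite eq_le cnorm_ge0 andbT.
rewrite leNgt; apply/negP => N0; set e := cnorm (star d * d) / 2.
have e0 : 0 < e by rewrite divr_gt0.
set a := e *r 1 - star d * d.
have sa : selfadj a by apply: selfadjB; [exact: selfadj_scalar | exact: selfadj_starM].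
have npa : ~ psd a.
  by move=> /(psd_cnorm_le (psd_starM d)); rewrite /e; lra.
pose P : set D := [set x | psd x].
have hP : preordering P.
  split; last exact: psd_mul; split=> //.
  - exact: psd_selfadj.
  - exact: psdD.
  - exact: psdR.
  - by rewrite -[1]rscale1 -rscaleNl => /psd_scalar_ge0; lra.
have [|f [hf fM] fp] := @preordering_character (adjoin P (- a)).
  apply: preordering_adjoin => //; first exact: selfadjN.
  move=> [p pp [q pq h]]; apply: npa.
  have [n [pn sm hm nm _]] := abs_exists sa; set m := n - a in sm hm nm.
  have qa : q * a = 1 + p by rewrite -[1]opprK -h mulrN opprD opprK addrAC addNr add0r.
  have pmm : psd (m * m) by exact: psd_sqr.
  have mm0 : m * m = 0.
    have : m * m + (m * m * p + q * n * (m * m)) = 0.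
      rewrite addrA -{1}[m * m]mulr1 -mulrDr -qa.
      by rewrite (comD (m * m)) -!mulrA (mulrA a) hm mulNr mulrN -!mulrA addNr.
    apply: psdD_eq0 => //; apply: psdD; first exact: psd_mul.
    by apply: psd_mul => //; exact: psd_mul.
  by move/(sqr_eq0_sa sm)/subr0_eq: mm0 => <-.
have : 0 <= Re (f (- a)).
  apply: fp; exists 0; first exact: psd0.
  by exists 1; [exact: psd1 | rewrite mul1r add0r].
rewrite /a opprB (stateB hf) fM (fd0 f) // mulr0 (state_scalar hf) /=; lra.
Qed.

End Characters.

(** * The algebra of bounded functions *)

Section ComplexComplete.
Context {R : realType}.
Local Notation normc := ComplexField.Normc.normc.

Lemma normcD (x y : R[i]) : normc (x + y) <= normc x + normc y.
Proof. exact: (@le_normcD R). Qed.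

Lemma normc_distC (x y : R[i]) : normc (x - y) = normc (y - x).
Proof. by rewrite -opprB (@normcN R). Qed.

Lemma normc_conj (x : R[i]) : normc (conjc x) = normc x.
Proof. by case: x => p q /=; rewrite sqrrN. Qed.

Lemma normc_le_ri (x : R[i]) : normc x <= `|Re x| + `|Im x|.
Proof.
case: x => p q /=; rewrite -(@ler_pXn2r _ 2) ?nnegrE ?sqrtr_ge0 ?addr_ge0 //.
rewrite sqr_sqrtr ?addr_ge0 ?sqr_ge0 // -(real_normK (num_real p)).
rewrite -(real_normK (num_real q)).
by have := normr_ge0 p; have := normr_ge0 q; nra.
Qed.

Lemma ri_le_normc (x : R[i]) : `|Re x| <= normc x /\ `|Im x| <= normc x.
Proof.
by case: x => p q /=; rewrite -2!sqrtr_sqr !ler_wsqrtr ?lerDl ?lerDr ?sqr_ge0.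
Qed.

(** The limit is the supremum of the eventual lower bounds. *)
Lemma real_complete (u : nat -> R) :
  (forall e, 0 < e -> exists N, forall m n, (N <= m)%N -> (N <= n)%N ->
     `|u m - u n| < e) ->
  exists l, forall e, 0 < e -> exists N, forall n, (N <= n)%N -> `|u n - l| < e.
Proof.
move=> cau; pose E : set R := [set r | exists N, forall n, (N <= n)%N -> r <= u n].
have ub N r e : (forall m n, (N <= m)%N -> (N <= n)%N -> `|u m - u n| < e) ->
    E r -> r <= u N + e.
  move=> hN [M hM]; have := hM _ (leq_maxr N M).
  by have := hN _ _ (leq_maxl N M) (leqnn N); rewrite ltr_norml => /andP[]; lra.
have lb N e : (forall m n, (N <= m)%N -> (N <= n)%N -> `|u m - u n| < e) ->
    E (u N - e).
  move=> hN; exists N => n Nn.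
  by have := hN _ _ Nn (leqnn N); rewrite ltr_norml => /andP[]; lra.
have supE : has_sup E.
  have [N hN] := cau 1 ltr01; split; first by exists (u N - 1); exact: lb.
  by exists (u N + 1) => r; exact: ub.
exists (sup E) => e e0; have e3 : 0 < e / 3 by lra.
have [N hN] := cau _ e3; exists N => n Nn.
have h1 : u N - e / 3 <= sup E by apply: ub_le_sup; [case: supE | exact: lb].
have h2 : sup E <= u N + e / 3.
  by apply: ge_sup; [case: supE | move=> r; exact: ub].
have := hN _ _ Nn (leqnn N); rewrite !ltr_norml => /andP[h3 h4].
by apply/andP; split; lra.
Qed.

Lemma complex_complete (u : nat -> R[i]) :
  (forall e, 0 < e -> exists N, forall m n, (N <= m)%N -> (N <= n)%N ->
     normc (u m - u n) < e) ->
  exists l, forall e, 0 < e -> exists N, forall n, (N <= n)%N -> normc (u n - l) < e.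
Proof.
move=> cau.
have ReB (x y : R[i]) : Re (x - y) = Re x - Re y by case: x; case: y.
have ImB (x y : R[i]) : Im (x - y) = Im x - Im y by case: x; case: y.
have [|p hp] := @real_complete (fun n => Re (u n)).
  move=> e /cau[N hN]; exists N => m n Nm Nn; apply: le_lt_trans (hN m n Nm Nn).
  by rewrite -ReB; case: (ri_le_normc (u m - u n)).
have [|q hq] := @real_complete (fun n => Im (u n)).
  move=> e /cau[N hN]; exists N => m n Nm Nn; apply: le_lt_trans (hN m n Nm Nn).
  by rewrite -ImB; case: (ri_le_normc (u m - u n)).
exists (p +i* q)%C => e e0; have e2 : 0 < e / 2 by lra.
have [M hM] := hp _ e2; have [N hN] := hq _ e2.
exists (maxn M N) => n; rewrite geq_max => /andP[Mn Nn].
apply: le_lt_trans (normc_le_ri _) _; rewrite ReB ImB /=.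
by have := hM n Mn; have := hN n Nn; lra.
Qed.

End ComplexComplete.

Section BoundedFunctions.
Context {R : realType}.
Local Notation normc := ComplexField.Normc.normc.

(** The base point makes the ring nontrivial. *)
Record linf (X : Type) (x0 : X) := Linf {
  linf_fun :> X -> R[i] ;
  linf_bounded : exists M : R, forall x, normc (linf_fun x) <= M }.

Variables (X : Type) (x0 : X).
Local Notation L := (linf x0).
Implicit Types f g h : L.

Lemma linf_ext f g : (forall x, f x = g x) -> f = g.
Proof.
case: f g => f bf [g bg] /= fg; have E : f = g by apply/funext.
by case: _ / E in bg *; congr Linf; exact: Prop_irrelevance.
Qed.

Lemma linf_cst_bounded (c : R[i]) : exists M : R, forall x : X, normc c <= M.
Proof. by exists (normc c). Qed.

Lemma linf_add_bounded f g : exists M : R, forall x, normc (f x + g x) <= M.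
Proof.
have [[M hM] [N hN]] := (linf_bounded f, linf_bounded g).
exists (M + N) => x; apply: le_trans (normcD _ _) _; exact: lerD.
Qed.

Lemma linf_mul_bounded f g : exists M : R, forall x, normc (f x * g x) <= M.
Proof.
have [[M hM] [N hN]] := (linf_bounded f, linf_bounded g).
exists (M * N) => x; rewrite ComplexField.Normc.normcM.
by apply: ler_pM => //; exact: normc_ge0.
Qed.

Lemma linf_scale_bounded (c : R[i]) f : exists M : R, forall x, normc (c * f x) <= M.
Proof.
have [M hM] := linf_bounded f; exists (normc c * M) => x.
by rewrite ComplexField.Normc.normcM ler_wpM2l ?normc_ge0.
Qed.

Lemma linf_opp_bounded f : exists M : R, forall x, normc (- f x) <= M.
Proof. by have [M hM] := linf_bounded f; exists M => x; rewrite (@normcN R). Qed.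

Lemma linf_conj_bounded f : exists M : R, forall x, normc (conjc (f x)) <= M.
Proof. by have [M hM] := linf_bounded f; exists M => x; rewrite normc_conj. Qed.

Definition linf_cst c : L := Linf x0 (linf_cst_bounded c).
Definition linf_add f g : L := Linf x0 (linf_add_bounded f g).
Definition linf_mul f g : L := Linf x0 (linf_mul_bounded f g).
Definition linf_scale c f : L := Linf x0 (linf_scale_bounded c f).
Definition linf_opp f : L := Linf x0 (linf_opp_bounded f).
Definition linf_conj f : L := Linf x0 (linf_conj_bounded f).

HB.instance Definition _ := gen_eqMixin L.
HB.instance Definition _ := gen_choiceMixin L.

Fact linf_addA : associative linf_add.
Proof. by move=> f g h; apply: linf_ext => x; exact: addrA. Qed.
Fact linf_addC : commutative linf_add.
Proof. by move=> f g; apply: linf_ext => x; exact: addrC. Qed.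
Fact linf_add0 : left_id (linf_cst 0) linf_add.
Proof. by move=> f; apply: linf_ext => x; exact: add0r. Qed.
Fact linf_addN : left_inverse (linf_cst 0) linf_opp linf_add.
Proof. by move=> f; apply: linf_ext => x; exact: addNr. Qed.

HB.instance Definition _ := GRing.isZmodule.Build L
  linf_addA linf_addC linf_add0 linf_addN.

Fact linf_mulA : associative linf_mul.
Proof. by move=> f g h; apply: linf_ext => x; exact: mulrA. Qed.
Fact linf_mul1 : left_id (linf_cst 1) linf_mul.
Proof. by move=> f; apply: linf_ext => x; exact: mul1r. Qed.
Fact linf_mulr1 : right_id (linf_cst 1) linf_mul.
Proof. by move=> f; apply: linf_ext => x; exact: mulr1. Qed.
Fact linf_mulDl : left_distributive linf_mul +%R.
Proof. by move=> f g h; apply: linf_ext => x; exact: mulrDl. Qed.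
Fact linf_mulDr : right_distributive linf_mul +%R.
Proof. by move=> f g h; apply: linf_ext => x; exact: mulrDr. Qed.
Fact linf_1neq0 : linf_cst 1 != 0.
Proof.
apply/eqP => /(congr1 (fun f : L => f x0)) /= /eqP.
by rewrite oner_eq0.
Qed.

HB.instance Definition _ := GRing.Zmodule_isNzRing.Build L
  linf_mulA linf_mul1 linf_mulr1 linf_mulDl linf_mulDr linf_1neq0.

Fact linf_scaleA a b f : linf_scale a (linf_scale b f) = linf_scale (a * b) f.
Proof. by apply: linf_ext => x; exact: mulrA. Qed.
Fact linf_scale1 : left_id 1 linf_scale.
Proof. by move=> f; apply: linf_ext => x; exact: mul1r. Qed.
Fact linf_scaleDr : right_distributive linf_scale +%R.
Proof. by move=> a f g; apply: linf_ext => x; exact: mulrDr. Qed.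
Fact linf_scaleDl f a b : linf_scale (a + b) f = linf_scale a f + linf_scale b f.
Proof. by apply: linf_ext => x; exact: mulrDl. Qed.

HB.instance Definition _ := GRing.Zmodule_isLmodule.Build R[i] L
  linf_scaleA linf_scale1 linf_scaleDr linf_scaleDl.

Fact linf_scaleAl a f g : a *: (f * g) = (a *: f) * g.
Proof. by apply: linf_ext => x; exact: mulrA. Qed.
Fact linf_scaleAr a f g : a *: (f * g) = f * (a *: g).
Proof. by apply: linf_ext => x; exact: mulrCA. Qed.

HB.instance Definition _ := GRing.Lmodule_isLalgebra.Build R[i] L linf_scaleAl.
HB.instance Definition _ := GRing.Lalgebra_isAlgebra.Build R[i] L linf_scaleAr.

Definition linf_norm f : R := sup (range (fun x => normc (f x))).

Lemma linf_norm_ub f x : normc (f x) <= linf_norm f.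
Proof.
apply: ub_le_sup; last by exists x.
by have [M hM] := linf_bounded f; exists M => _ [y _ <-].
Qed.

Lemma linf_norm_le f M : (forall x, normc (f x) <= M) -> linf_norm f <= M.
Proof.
move=> hM; apply: ge_sup; first by exists (normc (f x0)), x0.
by move=> _ [x _ <-].
Qed.

Lemma linf_norm_ge0 f : 0 <= linf_norm f.
Proof. exact: le_trans (normc_ge0 _) (linf_norm_ub f x0). Qed.

Fact linf_conjK : involutive linf_conj.
Proof. by move=> f; apply: linf_ext => x /=; case: (f x) => p q /=; rewrite opprK. Qed.
Fact linf_conjD f g : linf_conj (f + g) = linf_conj f + linf_conj g.
Proof. by apply: linf_ext => x /=; rewrite rmorphD. Qed.
Fact linf_conjZ a f : linf_conj (a *: f) = conjc a *: linf_conj f.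
Proof. by apply: linf_ext => x /=; rewrite rmorphM. Qed.
Fact linf_conjM f g : linf_conj (f * g) = linf_conj g * linf_conj f.
Proof. by apply: linf_ext => x /=; rewrite rmorphM mulrC. Qed.

Fact linf_norm_eq0 f : linf_norm f = 0 -> f = 0.
Proof.
move=> f0; apply: linf_ext => x; apply: ComplexField.Normc.eq0_normc.
by apply/eqP; rewrite eq_le normc_ge0 -{1}f0 linf_norm_ub.
Qed.
Fact linf_normD f g : linf_norm (f + g) <= linf_norm f + linf_norm g.
Proof.
apply: linf_norm_le => x; apply: le_trans (normcD _ _) _.
by apply: lerD; exact: linf_norm_ub.
Qed.
Fact linf_normM f g : linf_norm (f * g) <= linf_norm f * linf_norm g.
Proof.
apply: linf_norm_le => x; rewrite /= ComplexField.Normc.normcM.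
by apply: ler_pM; rewrite ?normc_ge0 ?linf_norm_ub.
Qed.
Fact linf_normZ a f : linf_norm (a *: f) = normc a * linf_norm f.
Proof.
have le (b : R[i]) g : linf_norm (b *: g) <= normc b * linf_norm g.
  apply: linf_norm_le => x; rewrite /= ComplexField.Normc.normcM.
  by rewrite ler_wpM2l ?normc_ge0 ?linf_norm_ub.
apply/eqP; rewrite eq_le le /=; have [->|a0] := eqVneq a 0.
  by rewrite ComplexField.Normc.normc0 mul0r linf_norm_ge0.
have := le a^-1 (a *: f); rewrite scalerA mulVf // scale1r.
rewrite ComplexField.Normc.normcV mulrC ler_pdivlMr ?[_ * linf_norm f]mulrC //.
rewrite lt_def normc_ge0 andbT.
by apply: contra_neq a0; exact: ComplexField.Normc.eq0_normc.
Qed.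
Fact linf_norm_conj f : linf_norm (linf_conj f * f) = linf_norm f ^+ 2.
Proof.
have E x : normc ((linf_conj f * f) x) = normc (f x) ^+ 2.
  by rewrite /= ComplexField.Normc.normcM normc_conj expr2.
apply/eqP; rewrite eq_le; apply/andP; split.
  apply: linf_norm_le => x; rewrite E ler_pXn2r ?nnegrE ?normc_ge0 ?linf_norm_ge0 //.
  exact: linf_norm_ub.
rewrite -[leRHS]sqr_sqrtr ?linf_norm_ge0 // ler_pXn2r ?nnegrE ?sqrtr_ge0 ?linf_norm_ge0 //.
apply: linf_norm_le => x.
rewrite -(@ler_pXn2r _ 2) ?nnegrE ?sqrtr_ge0 ?normc_ge0 // sqr_sqrtr ?linf_norm_ge0 //.
by rewrite -E linf_norm_ub.
Qed.

Fact linf_complete (u : nat -> L) :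
  (forall e : R, 0 < e -> exists N : nat, forall m n : nat,
       (N <= m)%N -> (N <= n)%N -> linf_norm (u m - u n) < e) ->
  exists l : L, forall e : R, 0 < e -> exists N : nat, forall n : nat,
      (N <= n)%N -> linf_norm (u n - l) < e.
Proof.
move=> cau.
have lim_x x : exists l : R[i], forall e : R, 0 < e ->
    exists N, forall n, (N <= n)%N -> normc (u n x - l) < e.
  apply: complex_complete => e /cau[N hN]; exists N => m n Nm Nn.
  by apply: le_lt_trans (hN m n Nm Nn); exact: (linf_norm_ub (u m - u n)).
have [l hl] := choice lim_x.
have unif e : 0 < e -> exists N, forall n x, (N <= n)%N -> normc (u n x - l x) <= e.
  move=> e0; have e2 : 0 < e / 2 by lra.
  have [N hN] := cau _ e2; exists N => n x Nn.
  have [M hM] := hl x _ e2; rewrite -(subrKA (u (maxn M N) x)).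
  apply: le_trans (normcD _ _) _.
  have := hM _ (leq_maxl M N); have := hN _ _ Nn (leq_maxr M N).
  have := linf_norm_ub (u n - u (maxn M N)) x => /=; lra.
have bl : exists M : R, forall x, normc (l x) <= M.
  have [N hN] := unif 1 ltr01; exists (linf_norm (u N) + 1) => x.
  have -> : l x = u N x + (l x - u N x) by rewrite addrC subrK.
  apply: le_trans (normcD _ _) _; apply: lerD; first exact: linf_norm_ub.
  by rewrite normc_distC hN.
exists (Linf x0 bl) => e e0; have e2 : 0 < e / 2 by lra.
have [N hN] := unif _ e2; exists N => n Nn.
have : linf_norm (u n - Linf x0 bl) <= e / 2 by apply: linf_norm_le => x; exact: hN.
by lra.
Qed.

HB.instance Definition _ := @isCStar.Build R L linf_conj linf_norm linf_conjK
  linf_conjD linf_conjZ linf_conjM linf_norm_eq0 linf_normD linf_normZ linf_normM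
  linf_norm_conj linf_complete.

End BoundedFunctions.

(** * Injectivity of the algebra of bounded functions *)

Section UcpPsd.
Context {R : realType} {A B : cstarAlgType R}.

Lemma posmx11 (y : A) : psd y -> posmx (const_mx y : 'M[A]_1).
Proof.
move=> /psd_sqrt[w [sw _ ww _]]; exists (const_mx w).
by apply/matrixP => i j; rewrite starmx_mulE big_ord1 !mxE sw ww.
Qed.

Lemma posmx11_psd (C : cstarAlgType R) (X : 'M[C]_1) : posmx X -> psd (X ord0 ord0).
Proof. by move=> [Y ->]; rewrite starmx_mulE big_ord1; exact: psd_starM. Qed.

Lemma ucp_psd (S : set A) (T : set B) (phi : A -> B) y :
  ucp S T phi -> S y -> psd y -> psd (phi y).
Proof.
move=> [_ h] Sy py.
have Sc i j : S ((const_mx y : 'M_1) i j) by rewrite mxE.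
by have /posmx11_psd := h 1 (const_mx y) Sc (posmx11 py); rewrite !mxE.
Qed.

Lemma ucp_unital_linear (T : set B) (phi : A -> B) :
  ucp setT T phi -> unital_linear phi.
Proof. by move=> [[_ hl h1] _]; split=> // a x y; exact: hl. Qed.

End UcpPsd.

Section StateFamilies.
Context {R : realType} {X : Type} (x0 : X).
Local Notation normc := ComplexField.Normc.normc.
Local Notation L := (linf (R := R) x0).

Lemma linf_sumE (I : Type) (s : seq I) (P : pred I) (F : I -> L) x :
  (\sum_(i <- s | P i) F i) x = \sum_(i <- s | P i) F i x.
Proof. exact: (big_morph (fun f : L => f x)). Qed.

Lemma linf_psdP (f : L) : psd f <-> forall x, 0 <= f x.
Proof.
split=> [/psd_sqrt[w [sw _ <- _]] x|f0].
  rewrite -{1}sw /=; case: (w x) => p q; rewrite lecE /=.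
  by apply/andP; split; [apply/eqP; ring | nra].
have fE x : f x = (Re (f x))%:C%C /\ 0 <= Re (f x).
  by have := f0 x; case: (f x) => p q /=; simpc => /andP[/eqP -> ->].
have bg : exists M : R, forall x, normc (Num.sqrt (Re (f x)))%:C%C <= M.
  have [M hM] := linf_bounded f; exists (1 + M) => y; have [_ r0] := fE y.
  rewrite /= expr0n addr0 sqrtr_sqr ger0_norm ?sqrtr_ge0 //.
  have := hM y; have [h _] := ri_le_normc (f y).
  rewrite (ger0_norm r0) in h; have := sqr_sqrtr r0; have := sqrtr_ge0 (Re (f y)).
  by nra.
have -> : f = star (Linf x0 bg) * Linf x0 bg; last exact: psd_starM.
apply: linf_ext => x /=; have [-> r0] := fE x; simpc.
by rewrite /= -expr2 sqr_sqrtr.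
Qed.

Context {A : cstarAlgType R}.

Lemma state_bounded (g : X -> A -> R[i]) : (forall x, state (g x)) ->
  forall a, exists M : R, forall x, normc (g x a) <= M.
Proof.
move=> hg a; exists (cnorm a + cnorm a) => x.
rewrite (state_ri (hg x)); apply: le_trans (normc_le_ri _) _ => /=.
apply: lerD; apply: (state_Re_le (hg x)).
- exact: selfadj_rpart.
- exact: cnorm_rpart.
- exact: selfadj_ipart.
- exact: cnorm_ipart.
Qed.

Variables (g : X -> A -> R[i]) (hg : forall x, state (g x)).

Definition state_map (a : A) : L := Linf x0 (state_bounded hg a).

(** Positivity of a matrix over the bounded functions is tested on vectors, and
    hence at each point [x] on complex vectors [c]; there it reduces to the
    positivity of the state [g x] at [c^* X c]. *)
Lemma state_map_posmx n (M : 'M[A]_n) : posmx M -> posmx (map_mx state_map M).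
Proof.
move=> [Y hY]; have sM : starmx M = M by rewrite hY starmx_mul starmxK.
apply: posmx_inner.
  apply/matrixP => i j; rewrite starmxE !mxE; apply: linf_ext => x /=.
  by rewrite -(state_star (hg x)) -starmxE sM.
move=> v; apply/linf_psdP => x.
pose c : 'cV[A]_n := \col_j ((v j ord0 : L) x *: 1).
have -> : inner v (map_mx state_map M *m v) x = g x (inner c (M *m c)).
  rewrite !innerE linf_sumE (state_sum (hg x)); apply: eq_bigr => i _.
  rewrite !mxE starZ star1 -scalerAl mul1r (stateZ (hg x)) (state_sum (hg x)).
  rewrite -[LHS]/(conjc ((v i ord0 : L) x) * _) linf_sumE; congr (_ * _).
  apply: eq_bigr => j _; rewrite !mxE -scalerAr mulr1 (stateZ (hg x)) mulrC.
  by [].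
apply: (state_ge0 (hg x)).
by rewrite hY -mulmxA -inner_adj; exact: psd_inner.
Qed.

Lemma state_map_ucp (S : set A) : ucp S setT state_map.
Proof.
split; last by move=> n M _; exact: state_map_posmx.
split=> // [a x y _ _|]; apply: linf_ext => p /=.
  by rewrite (stateD (hg p)) (stateZ (hg p)).
exact: state1 (hg p).
Qed.

End StateFamilies.

(** The coordinates of a ucp map are states, which extend one by one. *)
Theorem linf_injective (R : realType) (X : Type) (x0 : X) :
  injective_operator_system [set: linf (R := R) x0].
Proof.
split; first by split.
move=> B E F hE _ EF phi hphi; have [[_ phil phi1] _] := hphi.
have [E1 El _] := hE.
have ext x : exists g, state g /\ forall y, E y -> g y = phi y x.
  have fl (c : R[i]) y z : E y -> E z -> phi (c *: y + z) x = c * phi y x + phi z x.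
    by move=> Ey Ez; rewrite phil.
  have f1 : phi 1 x = 1 by rewrite phi1.
  have fp y : E y -> psd y -> 0 <= phi y x.
    by move=> Ey py; move: x {fl f1}; apply/linf_psdP/(ucp_psd hphi).
  have [|y Ey sy|g [hg gE _]] :=
      @state_extension _ _ E (fun b => phi b x) 0 0 hE fl f1 fp; last by exists g.
    exact: selfadj0.
  rewrite sub0r => pny.
  have E0 : E 0 by have := El (- 1) 1 1 E1 E1; rewrite scaleN1r addNr.
  have := fp (- y); have := phil (- 1) y 0 Ey E0; rewrite scaleN1r addr0 => ->.
  have -> : phi 0 = 0.
    by have := phil (- 1) 1 1 E1 E1; rewrite !scaleN1r !addNr.
  have := El (- 1) y 0 Ey E0; rewrite scaleN1r addr0 => ENy /(_ ENy pny) /=.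
  by rewrite addr0; case: (phi y x) => p q; simpc => /andP[_] /=; lra.
have [g hg] := choice ext.
have sg x : state (g x) by case: (hg x).
exists (state_map x0 sg); split; first exact: state_map_ucp.
by move=> y Ey; apply: linf_ext => x /=; case: (hg x) => _; apply.
Qed.

(** * Retractions onto an injective algebra *)

Section Maps.
Context {R : realType}.

Lemma operator_system_setT (A : cstarAlgType R) : operator_system [set: A].
Proof. by []. Qed.

Lemma positive_star (A B : cstarAlgType R) (phi : A -> B) : unital_linear phi ->
  (forall x, psd x -> psd (phi x)) -> forall x, phi (star x) = star (phi x).
Proof.
move=> hl pphi x; rewrite (ri_partE x).
have sr := selfadj_rpart x; have si := selfadj_ipart x.
have sa := positive_selfadj hl pphi.
rewrite starD star_i sr si (ulinB hl) (ulinD hl) !(ulinZ hl 'i%C).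
by rewrite starD star_i (sa _ sr) (sa _ si).
Qed.

Lemma ucp_comp (A B C : cstarAlgType R) (phi : A -> B) (psi : B -> C) :
  ucp setT setT phi -> ucp setT setT psi -> ucp setT setT (psi \o phi).
Proof.
move=> [[_ l1 u1] p1] [[_ l2 u2] p2]; split.
  by split=> // [a x y _ _|] /=; [rewrite l1 // l2 | rewrite u1].
by move=> n X _ pX; rewrite map_mx_comp; apply: p2 => //; exact: p1.
Qed.

Lemma cstar_embedding_star_hom (A B : cstarAlgType R) (j : {lrmorphism A -> B}) :
  cstar_embedding j -> star_hom j.
Proof.
by move=> [js _]; split=> // [|x y]; [split=> [a x y|]; rewrite ?linearP ?rmorph1 | rewrite rmorphM].
Qed.

Lemma cstar_embedding_inj (A B : cstarAlgType R) (j : {lrmorphism A -> B}) :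
  cstar_embedding j -> forall x, j x = 0 -> x = 0.
Proof. by move=> [_ jn] x jx; apply: cnorm_eq0; rewrite -jn jx cnorm0. Qed.

End Maps.

Section Retract.
Context {R : realType}.

Lemma star_hom_psdP (A B : cstarAlgType R) (j : A -> B) x :
  star_hom j -> (forall y, j y = 0 -> y = 0) -> psd (j x) -> psd x.
Proof.
move=> hj j_inj pjx; have := posmx11 pjx.
have -> : const_mx (j x) = map_mx j (const_mx x) :> 'M_1.
  by apply/matrixP => i k; rewrite !mxE.
by move/(star_hom_posmx hj j_inj)/posmx11_psd; rewrite mxE.
Qed.

(** Evaluation at the characters is an injective star homomorphism, hence
    isometric on matrices. *)
Lemma gelfand (D : cstarAlgType R) : (forall a b : D, a * b = b * a) ->
  exists (X : Type) (x0 : X) (tau : D -> linf (R := R) x0),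
    unital_complete_isometry setT setT tau.
Proof.
move=> comD.
have [f0 hf0] : exists f : D -> R[i], character f.
  apply: contrapT => nof; have /eqP := oner_eq0 D; apply.
  by apply: (character_separates comD) => f hf; case: nof; exists f.
pose X := {f : D -> R[i] | character f}.
have st (p : X) : state (sval p) by case: (svalP p).
exists X, (exist _ f0 hf0); set x0 := exist _ _ _.
have [[_ tl t1] _] := state_map_ucp x0 st setT.
have hom : star_hom (state_map x0 st).
  split; first by split=> // a x y; exact: tl.
  - by move=> x y; apply: linf_ext => p /=; case: (svalP p) => _; apply.
  - by move=> x; apply: linf_ext => p /=; rewrite (state_star (st p)).
exists (state_map x0 st); split; first by split.
move=> n M _; apply: star_hom_mxnorm => // d d0.
apply: (character_separates comD) => f hf.
exact: (congr1 (fun h : linf x0 => h (exist _ f hf)) d0).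
Qed.

Lemma complete_isometry_psd (A B : cstarAlgType R) (T : set B) (phi : A -> B) x :
  unital_complete_isometry setT T phi -> psd x -> psd (phi x).
Proof.
move=> hphi px.
have /posmx11_psd := (complete_isometry_posmx hphi _).1 (posmx11 px).
by rewrite !mxE.
Qed.

Lemma complete_isometry_inj (A B : cstarAlgType R) (T : set B) (phi : A -> B) :
  unital_complete_isometry setT T phi -> injective phi.
Proof.
move=> [[_ hl h1] iso] x y xy.
have pl : unital_linear phi by split=> // a u v; exact: hl.
have := iso 1 (const_mx (x - y)) (fun _ _ => I).
have -> : map_mx phi (const_mx (x - y)) = 0 :> 'M[B]_1.
  by apply/matrixP => i j; rewrite !mxE (ulinB pl) xy subrr.
have -> : cstar_mxnorm (0 : 'M[B]_1) = 0.
  apply/eqP; rewrite eq_le mxnorm_ge0 andbT; apply: le_trans (mxnorm_le_sum _) _.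
  by rewrite !big_ord1 mxE cnorm0.
move/esym/mxnorm_eq0/matrixP/(_ ord0 ord0); rewrite !mxE => /eqP.
by rewrite subr_eq0 => /eqP.
Qed.

(** The inverse of [tau] on its range is ucp, because a unital complete isometry
    reflects positivity, and it extends because [I] is injective. *)
Lemma injective_retract (I B : cstarAlgType R) (tau : I -> B) :
  injective_operator_system [set: I] -> unital_complete_isometry setT setT tau ->
  exists rho : B -> I, ucp setT setT rho /\ forall a, rho (tau a) = a.
Proof.
move=> [_ injI] htau; have [[_ tl t1] _] := htau.
have pl : unital_linear tau by split=> // a u v; exact: tl.
have tstar := positive_star pl (fun x => complete_isometry_psd htau).
have [jinv jinvK] : {jinv : B -> I & forall b, (exists a, tau a = b) -> tau (jinv b) = b}.
  apply: (@choice _ _ (fun b a => (exists a, tau a = b) -> tau a = b)) => b.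
  by have [[a <-]|nab] := pselect (exists a, tau a = b); [exists a | exists 0].
have tauK a : jinv (tau a) = a.
  by apply: (complete_isometry_inj htau); apply: jinvK; exists a.
have hE : operator_system (range tau).
  split; first by exists 1.
  - by move=> c _ _ [a _ <-] [b _ <-]; exists (c *: a + b) => //; rewrite tl.
  - by move=> _ [a _ <-]; exists (star a) => //; rewrite tstar.
have hjinv : ucp (range tau) setT jinv.
  split; first split=> //.
  - by move=> c _ _ [a _ <-] [b _ <-]; rewrite -tl // !tauK.
  - by rewrite -t1 tauK.
  - move=> n M ME pM; apply/(complete_isometry_posmx htau).
    suff -> : map_mx tau (map_mx jinv M) = M by [].
    apply/matrixP => i j; rewrite !mxE; apply: jinvK.
    by case: (ME i j) => a _ <-; exists a.
have [rho [hrho rhoE]] := injI _ _ _ hE (operator_system_setT B) (@subsetT _ _) _ hjinv.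
by exists rho; split=> // a; rewrite rhoE ?tauK //; exists a.
Qed.

End Retract.

(** * Pseudo-expectations *)

Section PseudoExpectations.
Context {R : realType} {C D I : cstarAlgType R}.
Variables (jC : {lrmorphism D -> C}) (jI : {lrmorphism D -> I}).
Hypothesis hC : cstar_embedding jC.
Hypothesis hD : forall a b : D, a * b = b * a.
Hypothesis hI : injective_envelope jI.

Let homC := cstar_embedding_star_hom hC.

Lemma jI_embedding : cstar_embedding jI. Proof. by case: hI. Qed.

Let homI := cstar_embedding_star_hom jI_embedding.

Lemma embedding_left_inverse : exists jinv : C -> D, forall d, jinv (jC d) = d.
Proof.
have [jinv jinvK] : {jinv : C -> D & forall c, (exists d, jC d = c) -> jC (jinv c) = c}.
  apply: (@choice _ _ (fun c d => (exists d, jC d = c) -> jC d = c)) => c.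
  by have [[d <-]|ndc] := pselect (exists d, jC d = c); [exists d | exists 0].
exists jinv => d; apply/subr0_eq/(cstar_embedding_inj hC).
by rewrite rmorphB /= jinvK ?subrr //; exists d.
Qed.

Lemma operator_system_jC : operator_system (range jC).
Proof.
have [_ _ js] := homC.
split; first by exists 1 => //; rewrite rmorph1.
- by move=> c _ _ [a _ <-] [b _ <-]; exists (c *: a + b) => //; rewrite linearP.
- by move=> _ [a _ <-]; exists (star a) => //; rewrite js.
Qed.

(** [jC] and [jI] preserve and reflect the positivity of matrices, so
    [jI \o jC^-1] is ucp on the range of [jC] and extends to [C]. *)
Lemma pseudo_expectation_exists : exists Phi, pseudo_expectation jC jI Phi.
Proof.
have [jinv jinvK] := embedding_left_inverse.
have hphi : ucp (range jC) setT (jI \o jinv).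
  split; first split=> //.
  - move=> c _ _ [a _ <-] [b _ <-] /=.
    by rewrite -linearP !jinvK linearP.
  - by rewrite /= -(rmorph1 jC) jinvK rmorph1.
  - move=> n M ME pM; rewrite map_mx_comp.
    apply/(star_hom_posmx homI (cstar_embedding_inj jI_embedding)).
    apply/(star_hom_posmx homC (cstar_embedding_inj hC)).
    suff -> : map_mx jC (map_mx jinv M) = M by [].
    by apply/matrixP => i j; rewrite !mxE; case: (ME i j) => d _ <-; rewrite jinvK.
have [_ [_ injI] _] := hI.
have [Phi [hPhi PhiE]] :=
  injI _ _ _ operator_system_jC (operator_system_setT C) (@subsetT _ _) _ hphi.
by exists Phi; split=> // d; rewrite PhiE /= ?jinvK //; exists d.
Qed.

Section OnePseudoExpectation.
Variable Phi : C -> I.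
Hypothesis hPhi : pseudo_expectation jC jI Phi.

Lemma pe_linear : unital_linear Phi.
Proof. by case: hPhi => + _; exact: ucp_unital_linear. Qed.

Lemma pe_psd x : psd x -> psd (Phi x).
Proof. by case: hPhi => h _; exact: (ucp_psd h). Qed.

Lemma pe_selfadj x : selfadj x -> selfadj (Phi x).
Proof. exact: positive_selfadj pe_linear pe_psd x. Qed.

Lemma pe_minorant x d : minorants jC jI x d -> cstar_le d (Phi x).
Proof.
move=> [e [_ /cstar_leE ex] <-]; apply/cstar_leE.
by case: hPhi => _ <-; rewrite -(ulinB pe_linear); exact: pe_psd.
Qed.

Lemma pe_majorant x d : majorants jC jI x d -> cstar_le (Phi x) d.
Proof.
move=> [e [_ /cstar_leE ex] <-]; apply/cstar_leE.
by case: hPhi => _ <-; rewrite -(ulinB pe_linear); exact: pe_psd.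
Qed.

End OnePseudoExpectation.

(** [I] is a retract of an algebra of bounded functions.  At each point [p],
    extend to [C] the state which [tau (jI d) p] defines on [D], with the least
    possible value at [x]; the resulting map into the bounded functions is then
    at [x] the pointwise supremum of the minorants, and [rho] takes it to their
    supremum in [I]. *)
Lemma pseudo_expectation_sup x : selfadj x ->
  exists2 Phi, pseudo_expectation jC jI Phi & is_sup_sa (minorants jC jI x) (Phi x).
Proof.
move=> sx; have [_ injI envI] := hI.
have [X [x0 [tau0 htau0]]] := gelfand hD.
have [tau [htau _]] := envI _ _ (linf_injective R x0) _ htau0.
have [rho [hrho rhoK]] := injective_retract injI htau.
have [[_ tl t1] _] := htau.
have tlin : unital_linear tau by split=> // a u v; exact: tl.
have tpsd a : psd a -> psd (tau a) by exact: complete_isometry_psd htau.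
have [jinv jinvK] := embedding_left_inverse.
have [jCl _ jCs] := homC; have [jIl _ _] := homI.
have jC_psd d : psd (jC d) -> psd d.
  exact: (star_hom_psdP homC (cstar_embedding_inj hC)).
have ti_psd d p : psd d -> 0 <= tau (jI d) p.
  by move=> pd; move: p; apply/linf_psdP/tpsd/(star_hom_psd homI).
have tiD c d e p : tau (jI (c *: d + e)) p = c * tau (jI d) p + tau (jI e) p.
  by rewrite linearP tl.
have ti1 p : tau (jI 1) p = 1 by rewrite rmorph1 t1.
have ti_state p : state (fun d => tau (jI d) p) by split=> // d; exact: ti_psd.
pose V p : set R := [set Re (tau (jI d) p) | d in
  [set d | selfadj d /\ psd (x - jC d)]].
have supV p : has_sup (V p).
  split.
    exists (Re (tau (jI ((- cnorm x) *r 1)) p)), ((- cnorm x) *r 1) => //; split.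
      exact: selfadj_scalar.
    rewrite (ulin_scalar jCl) rscaleNl opprK addrC.
    exact/psd_ge_norm/lexx.
  exists (cnorm x) => _ [d [sd pd] <-].
  have : psd (cnorm x *r 1 - d).
    apply: jC_psd; rewrite (ulinB jCl) (ulin_scalar jCl) -(subrKA x).
    by apply: psdD => //; exact/psd_le_norm/lexx.
  move/(state_Re_ge0 (ti_state p)).
  rewrite (stateB (ti_state p)) (state_scalar (ti_state p)).
  by case: (tau (jI d) p) => u v /=; lra.
have ext p : exists g, [/\ state g, forall d, g (jC d) = tau (jI d) p &
    Re (g x) <= sup (V p)].
  have [||||y [d _ <-] syd py|g [hg gE gx]] := @state_extension _ _ (range jC)
    (fun c => tau (jI (jinv c)) p) x (sup (V p)) operator_system_jC => //.
  - by move=> c _ _ [d _ <-] [e _ <-]; rewrite -linearP !jinvK tiD.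
  - by rewrite -(rmorph1 jC) jinvK ti1.
  - by move=> _ [d _ <-] /jC_psd pd; rewrite jinvK; exact: ti_psd.
  - rewrite jinvK; apply: sup_upper_bound => //; exists d => //; split=> //.
    apply/subr0_eq/(cstar_embedding_inj hC).
    by rewrite (ulinB jCl) jCs syd subrr.
  - exists g; split=> // d; rewrite gE ?jinvK //; by exists d.
have [g hg] := choice ext.
have sg p : state (g p) by case: (hg p).
have gjC p d : g p (jC d) = tau (jI d) p by case: (hg p).
have hPhi : pseudo_expectation jC jI (rho \o state_map x0 sg).
  split; first by apply: ucp_comp => //; exact: state_map_ucp.
  move=> d /=; rewrite -[RHS]rhoK; congr rho.
  by apply: linf_ext => p /=; exact: gjC.
exists (rho \o state_map x0 sg) => //; split; first exact: (pe_selfadj hPhi).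
  by move=> d; exact: (pe_minorant hPhi).
move=> u su hu; apply/cstar_leE => /=.
have rlin := ucp_unital_linear hrho.
rewrite -[u]rhoK -(ulinB rlin); apply: (ucp_psd hrho) => //.
apply/linf_psdP => p.
have tau_state : state (fun a => tau a p).
  split=> [c a b||a pa]; rewrite ?tl ?t1 //.
  by move: p; apply/linf_psdP/tpsd.
rewrite -[_ p]/(tau u p - g p x) (state_real tau_state su) (state_real (sg p) sx).
rewrite -rmorphB ler0c subr_ge0; case: (hg p) => _ _ /le_trans; apply.
apply: ge_sup; first by case: (supV p).
move=> _ [d [sd pd] <-].
have /cstar_leE/(state_Re_ge0 tau_state) : cstar_le (jI d) u.
  by apply: hu; exists d => //; split=> //; exact/cstar_leE.
rewrite (stateB tau_state).
by case: (tau u p); case: (tau (jI d) p) => a b c d' /=; lra.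
Qed.

(** The majorants of [x] are the negatives of the minorants of [- x]. *)
Lemma pseudo_expectation_inf x : selfadj x ->
  exists2 Phi, pseudo_expectation jC jI Phi & is_inf_sa (majorants jC jI x) (Phi x).
Proof.
move=> sx; have [Phi hPhi [_ _ lub]] := pseudo_expectation_sup (selfadjN sx).
exists Phi => //; split; first exact: pe_selfadj.
  by move=> d; exact: pe_majorant.
move=> u su hu; apply/cstar_leE.
have := lub (- u) (selfadjN su).
rewrite (ulinN (pe_linear hPhi)) => lubu; have /cstar_leE : cstar_le (- Phi x) (- u).
  apply: lubu => _ [d [sd /cstar_leE xd] <-]; apply/cstar_leE.
  have /hu/cstar_leE : majorants jC jI x (jI (- d)).
    exists (- d) => //; split; first exact: selfadjN.
    by apply/cstar_leE; move: xd; rewrite raddfN addrC.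
  by rewrite raddfN addrC.
by rewrite opprK addrC.
Qed.

Lemma unique_pseudo_expectation_sup_inf x :
  unique_pseudo_expectation jC jI -> selfadj x ->
  exists s : I, is_sup_sa (minorants jC jI x) s /\
                is_inf_sa (majorants jC jI x) s.
Proof.
move=> [Phi [_ uniq]] sx.
have [Psi hPsi Psi_sup] := pseudo_expectation_sup sx.
have [Psi' hPsi' Psi_inf] := pseudo_expectation_inf sx.
rewrite -(uniq _ hPsi) in Psi_sup; rewrite -(uniq _ hPsi') in Psi_inf.
by exists (Phi x).
Qed.

Lemma sup_inf_unique_pseudo_expectation :
  (forall x : C, selfadj x ->
     exists s : I, is_sup_sa (minorants jC jI x) s /\
                   is_inf_sa (majorants jC jI x) s) ->
  unique_pseudo_expectation jC jI.
Proof.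
move=> sup_inf.
have [Phi hPhi] := pseudo_expectation_exists.
exists Phi; split=> // Psi hPsi.
have agree x : selfadj x -> Phi x = Psi x.
  move=> sx; have [s [[ss _ lub] [_ _ glb]]] := sup_inf x sx.
  have pin Xi : pseudo_expectation jC jI Xi -> Xi x = s.
    move=> hXi; have sXi := pe_selfadj hXi sx.
    apply/subr0_eq/psd_anti.
      by apply/cstar_leE/lub => // d; exact: pe_minorant.
    by rewrite opprB; apply/cstar_leE/glb => // d; exact: pe_majorant.
  by rewrite !pin.
apply/funext => x.
have split_ri Xi : pseudo_expectation jC jI Xi ->
    Xi x = Xi (rpart x) + 'i%C *: Xi (ipart x).
  move=> /pe_linear hl.
  by rewrite [in LHS](ri_partE x) (ulinD hl) (ulinZ hl 'i%C).
rewrite !split_ri // (agree _ (selfadj_rpart x)).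
by rewrite (agree _ (selfadj_ipart x)).
Qed.

End PseudoExpectations.

Theorem theorem3p16 (R : realType) (C D I : cstarAlgType R)
    (jC : {lrmorphism D -> C}) (jI : {lrmorphism D -> I})
    (hC : cstar_embedding jC)
    (hD : forall a b : D, a * b = b * a)
    (hI : injective_envelope jI) :
  unique_pseudo_expectation jC jI <->
  (forall x : C, selfadj x ->
     exists s : I, is_sup_sa (minorants jC jI x) s /\
                   is_inf_sa (majorants jC jI x) s).
Proof.
split; last exact: sup_inf_unique_pseudo_expectation.
by move=> uniq x; exact: unique_pseudo_expectation_sup_inf.
Qed.
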